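(* For every $p \in (2,\infty)$ there exists a sectorial operator $A$ on $L_p([0,1])$ with sectorial angle $\omega(A) = 0$ which is not $\mathcal{R}$-sectorial.
   Context: All Banach spaces are complex. For $\omega \in (0,\pi)$ let $\Sigma_\omega = \{z \in \mathbb{C}\setminus\{0\} : |\arg z| < \omega\}$, with $\arg z \in (-\pi,\pi]$. A closed densely defined operator $A$ with dense range on a Banach space $X$ is called sectorial if there is $\omega \in (0,\pi)$ such that $\sigma(A) \subset \overline{\Sigma_\omega}$ and $\sup_{\lambda \notin \overline{\Sigma_{\omega+\varepsilon}}} \|\lambda R(\lambda,A)\| < \infty$ for all $\varepsilon > 0$, where $R(\lambda,A) = (\lambda - A)^{-1}$; such operators are automatically injective. The sectorial angle $\omega(A)$ is the infimum of all $\omega \in (0,\pi)$ for which this holds. Let $r_k(t) = \operatorname{sign}\sin(2^k\pi t)$ be the $k$-th Rademacher function on $[0,1]$. A family $\mathcal{T} \subseteq \mathcal{B}(X)$ of bounded operators is $\mathcal{R}$-bounded if for one (equivalently all) $q \in [1,\infty)$ there is a finite constant $C_q \ge 0$ such that for every finite subset $\{T_1,\dots,T_n\}$ of $\mathcal{T}$ and all $x_1,\dots,x_n \in X$ one has $\|\sum_{k=1}^n r_k T_k x_k\|_{L_q([0,1];X)} \le C_q \|\sum_{k=1}^n r_k x_k\|_{L_q([0,1];X)}$. A sectorial operator $A$ is $\mathcal{R}$-sectorial if for some $\omega \in (\omega(A),\pi)$ the set $\{\lambda R(\lambda,A) : \lambda \notin \overline{\Sigma_\omega}\}$ is $\mathcal{R}$-bounded.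 *)

(* Defs.v *)
From HB Require Import structures.
From mathcomp Require Import all_boot all_order all_algebra.
From mathcomp Require Import complex.
From mathcomp Require Import all_classical all_reals all_analysis.
From mathcomp Require Import measurable_realfun.
From mathcomp Require Import ring.

Set Implicit Arguments.
Unset Strict Implicit.
Unset Printing Implicit Defensive.

Import Order.TTheory GRing.Theory Num.Theory.
Import numFieldTopology.Exports numFieldNormedType.Exports.

Local Open Scope classical_set_scope.
Local Open Scope ring_scope.
Local Open Scope complex_scope.
Local Open Scope quotient_scope.

(* Norms over the scalar field R[i] take their values in R[i]. *)
Definition rnorm (R : realType) (V : normedZmodType R[i]) (x : V) : R :=
  complex.Re `|x|.

Section rnorm_theory.
Context (R : realType) (V : normedZmodType R[i]).
Implicit Types x y : V.

Lemma rnormE x : `|x| = (rnorm x)%:C.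
Proof.
have : (0 : R[i]) <= `|x| by exact: normr_ge0.
by rewrite /rnorm; case: `|x| => a b; rewrite lecE /= => /andP[/eqP -> _].
Qed.

Lemma rnorm_ge0 x : 0 <= rnorm x.
Proof. by rewrite -lecR -rnormE normr_ge0. Qed.

Lemma ler_rnormD x y : rnorm (x + y) <= rnorm x + rnorm y.
Proof. by rewrite -lecR rmorphD /= -!rnormE ler_normD. Qed.

Lemma rnorm_eq0 x : rnorm x = 0 -> x = 0.
Proof. by move=> x0; apply/eqP; rewrite -normr_eq0 rnormE x0. Qed.

Lemma rnorm0 : rnorm (0 : V) = 0.
Proof. by rewrite /rnorm normr0. Qed.

End rnorm_theory.

Lemma rnormM (R : realType) (a b : R[i]) : rnorm (a * b) = rnorm a * rnorm b.
Proof. by apply: complexI; rewrite rmorphM /= -!rnormE normrM. Qed.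

Section Lp_functions.
Context d (T : measurableType d) (R : realType).
Variables (mu : {measure set T -> \bar R}) (p : R).
Implicit Types f g : T -> R[i].

Definition Lpnorm f : \bar R := 'N[mu]_(p%:E)[(fun x => (rnorm (f x))%:E)]%E.

Definition isLp f : Prop :=
  [/\ measurable_fun setT (fun x => complex.Re (f x)),
      measurable_fun setT (fun x => complex.Im (f x)) &
      (Lpnorm f < +oo)%E].

Definition Lp_pred : {pred T -> R[i]} := [pred f | `[< isLp f >]].

Lemma isLpP f : reflect (isLp f) (f \in Lp_pred).
Proof. exact: asboolP. Qed.

Lemma rnorm_sqrt (z : R[i]) :
  rnorm z = Num.sqrt (complex.Re z ^+ 2 + complex.Im z ^+ 2).
Proof. by rewrite /rnorm normc_def. Qed.

Lemma measurable_rnorm f : measurable_fun setT (fun x => complex.Re (f x)) ->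
  measurable_fun setT (fun x => complex.Im (f x)) ->
  measurable_fun setT (fun x => rnorm (f x)).
Proof.
move=> mr mi; rewrite (_ : (fun x => _) = Num.sqrt \o
  (fun x => complex.Re (f x) ^+ 2 + complex.Im (f x) ^+ 2)); last first.
  by apply/funext => x; rewrite /= rnorm_sqrt.
apply: measurableT_comp => //.
  by apply: continuous_measurable_fun; exact: sqrt_continuous.
by apply: measurable_funD; apply: measurable_funX.
Qed.

Hypothesis p1 : 1 <= p.
Let p0 : 0 < p. Proof. exact: lt_le_trans p1. Qed.

Lemma Lpnorm_ge0 f : (0 <= Lpnorm f)%E.
Proof. exact: Lnorm_ge0. Qed.

Lemma le_Lpnorm (u v : T -> R) :
  measurable_fun setT u -> measurable_fun setT v ->
  (forall x, 0 <= u x <= v x) ->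
  ('N[mu]_(p%:E)[EFin \o u] <= 'N[mu]_(p%:E)[EFin \o v])%E.
Proof.
move=> mu_ mv uv; rewrite unlock /=.
have mp (w : T -> R) : measurable_fun setT w ->
    measurable_fun setT (fun x => (`|(w x)%:E| `^ p)%E).
  move=> mw; apply: (@measurableT_comp _ _ _ _ _ _ (fun y : \bar R => (y `^ p)%E)).
    exact: measurable_poweR.
  by apply: measurableT_comp => //; exact/measurable_EFinP.
apply: gt0_ler_poweR.
- by rewrite invr_ge0 ltW.
- by rewrite in_itv/= leey integral_ge0.
- by rewrite in_itv/= leey integral_ge0.
apply: ge0_le_integral => //; [exact: mp..|].
move=> x _; have /andP[u0 uvx] := uv x.
rewrite !lee_fin !ger0_norm ?(le_trans u0)//.
by apply: ge0_ler_powR => //; rewrite ?nnegrE ?(ltW p0)// (le_trans u0).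
Qed.

Lemma Lpnorm0 : Lpnorm (fun=> 0) = 0%E.
Proof.
rewrite /Lpnorm (_ : (fun x => _) = cst 0%E); last first.
  by apply/funext => x; rewrite rnorm0.
by rewrite Lnorm0// eqe gt_eqF.
Qed.

Lemma LpnormD f g : isLp f -> isLp g ->
  (Lpnorm (fun x => f x + g x)%R <= Lpnorm f + Lpnorm g)%E.
Proof.
move=> [f1 f2 _] [g1 g2 _].
have mf := measurable_rnorm f1 f2; have mg := measurable_rnorm g1 g2.
apply: (@le_trans _ _ ('N[mu]_(p%:E)[EFin \o
   ((fun x => rnorm (f x)) \+ (fun x => rnorm (g x)))%R])%E); last first.
  exact: minkowski_EFin.
apply: le_Lpnorm.
- apply: measurable_rnorm.
    rewrite (_ : (fun x => _) =
       (fun x => complex.Re (f x)) \+ (fun x => complex.Re (g x))).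
      exact: measurable_funD.
    by apply/funext => x /=; case: (f x) (g x) => ? ? [].
  rewrite (_ : (fun x => _) =
     (fun x => complex.Im (f x)) \+ (fun x => complex.Im (g x))).
    exact: measurable_funD.
  by apply/funext => x /=; case: (f x) (g x) => ? ? [].
- exact: measurable_funD.
- by move=> x; rewrite rnorm_ge0 ler_rnormD.
Qed.

Lemma LpnormZ (a : R[i]) f :  isLp f ->
  (Lpnorm (fun x => a * f x)%R = (rnorm a)%:E * Lpnorm f)%E.
Proof.
move=> [f1 f2 _].
have mf := measurable_rnorm f1 f2.
rewrite /Lpnorm unlock /=.
under eq_integral => x _.
  rewrite rnormM normrM powRM//= EFinM (ger0_norm (rnorm_ge0 a)).
  over.
rewrite ge0_integralZl_EFin ?powR_ge0//; last first.
  apply/measurable_EFinP.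
  apply: (@measurableT_comp _ _ _ _ _ _ (@powR R ^~ p)) => //.
  exact: measurableT_comp.
rewrite poweRM; last 2 first.
- by rewrite lee_fin powR_ge0.
- by apply: integral_ge0 => x _; rewrite lee_fin powR_ge0.
by rewrite poweR_EFin -powRrM mulfV ?gt_eqF// powRr1// rnorm_ge0.
Qed.

Lemma Lp_submod_closed : submod_closed Lp_pred.
Proof.
split.
  apply/isLpP; split; [exact: measurable_cst..|].
  by rewrite Lpnorm0 ltry.
move=> a f g /isLpP Lf /isLpP Lg; apply/isLpP.
have [f1 f2 f3] := Lf; have [g1 g2 g3] := Lg.
have La : isLp (fun x => a * f x).
  split.
  - rewrite (_ : (fun x => _) =
       (fun x => complex.Re a * complex.Re (f x)) \-
       (fun x => complex.Im a * complex.Im (f x))).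
      by apply: measurable_funB; apply: measurable_funM.
    by apply/funext => x /=; case: a (f x) => ? ? [].
  - rewrite (_ : (fun x => _) =
       (fun x => complex.Re a * complex.Im (f x)) \+
       (fun x => complex.Im a * complex.Re (f x))).
      by apply: measurable_funD; apply: measurable_funM.
    by apply/funext => x /=; case: a (f x) => ? ? [].
  - by rewrite LpnormZ// lte_mul_pinfty// lee_fin rnorm_ge0.
have [a1 a2 a3] := La.
rewrite (_ : a *: f + g = fun x => a * f x + g x)//; split.
- rewrite (_ : (fun x => _) =
     (fun x => complex.Re (a * f x)) \+ (fun x => complex.Re (g x))).
    exact: measurable_funD.
  by apply/funext => x /=; case: (a * f x) (g x) => ? ? [].
- rewrite (_ : (fun x => _) =
     (fun x => complex.Im (a * f x)) \+ (fun x => complex.Im (g x))).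
    exact: measurable_funD.
  by apply/funext => x /=; case: (a * f x) (g x) => ? ? [].
- by apply: le_lt_trans (LpnormD La Lg) _; rewrite lte_add_pinfty.
Qed.

End Lp_functions.

Section Lp_space.
Context d (T : measurableType d) (R : realType).
Variables (mu : {measure set T -> \bar R}) (p : R) (p1 : 1 <= p).
Implicit Types f g : T -> R[i].

Definition Lp_ae_eq (f g : {f : T -> R[i] | f \in Lp_pred mu p}) : bool :=
  `[< sval f = sval g %[ae mu] >].

Lemma Lp_ae_eq_equiv : equiv_class_of Lp_ae_eq.
Proof.
split.
- by move=> f; apply/asboolP; exact: ae_eq_refl.
- by move=> f g; apply/idP/idP => /asboolP fg; apply/asboolP; exact: ae_eq_sym.
- by move=> g f h /asboolP fg /asboolP gh; apply/asboolP; exact: ae_eq_trans fg gh.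
Qed.

Canonical Lp_ae_eq_rel := EquivRelPack Lp_ae_eq_equiv.

(* The unused proof of 1 <= p is kept as a parameter so that the algebraic and
   normed structures below can be inferred from the type alone. *)
Definition Lp (_ : 1 <= p) : Type := {eq_quot Lp_ae_eq}.

Local Notation V := (Lp p1).
HB.instance Definition _ := Choice.on V.
HB.instance Definition _ := EqQuotient.on V.

Definition Lp_class f (Lf : f \in Lp_pred mu p) : V :=
  \pi_V (exist _ f Lf : {f : T -> R[i] | f \in Lp_pred mu p}).

Definition Lp_fun (x : V) : T -> R[i] := sval (repr x).

Lemma Lp_funP (x : V) : Lp_fun x \in Lp_pred mu p.
Proof. exact: valP (repr x). Qed.

Lemma Lp_class_eq f g (Lf : f \in Lp_pred mu p) (Lg : g \in Lp_pred mu p) :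
  f = g %[ae mu] <-> Lp_class Lf = Lp_class Lg.
Proof.
by split => [fg|/eqmodP /asboolP//]; apply/eqmodP/asboolP.
Qed.

Lemma Lp_funK (x : V) : Lp_class (Lp_funP x) = x.
Proof.
rewrite /Lp_class -[RHS]reprK; congr (\pi_V _).
by apply/val_inj.
Qed.

Lemma Lp_classK f (Lf : f \in Lp_pred mu p) : Lp_fun (Lp_class Lf) = f %[ae mu].
Proof. by apply/(Lp_class_eq (Lp_funP _) Lf); rewrite Lp_funK. Qed.

Lemma Lp_eqP (x y : V) : x = y <-> Lp_fun x = Lp_fun y %[ae mu].
Proof. by rewrite (Lp_class_eq (Lp_funP x) (Lp_funP y)) !Lp_funK. Qed.

Lemma Lp_ind (P : V -> Prop) :
  (forall f (Lf : f \in Lp_pred mu p), P (Lp_class Lf)) -> forall x, P x.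
Proof. by move=> Pf x; rewrite -(Lp_funK x). Qed.

Lemma Lp_class_congr f g (Lf : f \in Lp_pred mu p) (Lg : g \in Lp_pred mu p) :
  f =1 g -> Lp_class Lf = Lp_class Lg.
Proof. by move=> fg; apply/Lp_class_eq/nearW => t _; exact: fg. Qed.

Lemma Lp_pred0 : (0 : T -> R[i]) \in Lp_pred mu p.
Proof. by case: (Lp_submod_closed mu p1). Qed.

Lemma Lp_predZ a f : f \in Lp_pred mu p -> a *: f \in Lp_pred mu p.
Proof.
move=> Lf; rewrite -[_ *: _]addr0.
by apply: (Lp_submod_closed mu p1).2 => //; exact: Lp_pred0.
Qed.

Lemma Lp_predD f g :
  f \in Lp_pred mu p -> g \in Lp_pred mu p -> f + g \in Lp_pred mu p.
Proof.
by move=> Lf Lg; rewrite -[f]scale1r; apply: (Lp_submod_closed mu p1).2.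
Qed.

Lemma Lp_predN f : f \in Lp_pred mu p -> - f \in Lp_pred mu p.
Proof. by move=> Lf; rewrite -scaleN1r; exact: Lp_predZ. Qed.

Definition Lp_zero : V := Lp_class Lp_pred0.
Definition Lp_opp (x : V) : V := Lp_class (Lp_predN (Lp_funP x)).
Definition Lp_add (x y : V) : V := Lp_class (Lp_predD (Lp_funP x) (Lp_funP y)).
Definition Lp_scale (a : R[i]) (x : V) : V := Lp_class (Lp_predZ a (Lp_funP x)).

Lemma Lp_addE f g (Lf : f \in Lp_pred mu p) (Lg : g \in Lp_pred mu p) :
  Lp_add (Lp_class Lf) (Lp_class Lg) = Lp_class (Lp_predD Lf Lg).
Proof.
apply/Lp_class_eq; apply: filterS2 (Lp_classK Lf) (Lp_classK Lg) => t /= ft gt _.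
by rewrite !fctE ft// gt.
Qed.

Lemma Lp_oppE f (Lf : f \in Lp_pred mu p) :
  Lp_opp (Lp_class Lf) = Lp_class (Lp_predN Lf).
Proof.
apply/Lp_class_eq; apply: filterS (Lp_classK Lf) => t /= ft _.
by rewrite !fctE ft.
Qed.

Lemma Lp_scaleE a f (Lf : f \in Lp_pred mu p) :
  Lp_scale a (Lp_class Lf) = Lp_class (Lp_predZ a Lf).
Proof.
apply/Lp_class_eq; apply: filterS (Lp_classK Lf) => t /= ft _.
by rewrite !fctE ft.
Qed.

Lemma Lp_addA : associative Lp_add.
Proof.
elim/Lp_ind => f Lf; elim/Lp_ind => g Lg; elim/Lp_ind => h Lh.
by rewrite !Lp_addE; apply: Lp_class_congr => t; rewrite !fctE addrA.
Qed.

Lemma Lp_addC : commutative Lp_add.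
Proof.
elim/Lp_ind => f Lf; elim/Lp_ind => g Lg.
by rewrite !Lp_addE; apply: Lp_class_congr => t; rewrite !fctE addrC.
Qed.

Lemma Lp_add0 : left_id Lp_zero Lp_add.
Proof.
elim/Lp_ind => f Lf.
by rewrite Lp_addE; apply: Lp_class_congr => t; rewrite !fctE add0r.
Qed.

Lemma Lp_addN : left_inverse Lp_zero Lp_opp Lp_add.
Proof.
elim/Lp_ind => f Lf.
by rewrite Lp_oppE Lp_addE; apply: Lp_class_congr => t; rewrite !fctE addNr.
Qed.

HB.instance Definition _ :=
  GRing.isZmodule.Build V Lp_addA Lp_addC Lp_add0 Lp_addN.

Lemma Lp_scaleA a b (x : V) : Lp_scale a (Lp_scale b x) = Lp_scale (a * b) x.
Proof.
elim/Lp_ind: x => f Lf.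
by rewrite !Lp_scaleE; apply: Lp_class_congr => t; rewrite !fctE scalerA.
Qed.

Lemma Lp_scale1 : left_id 1 Lp_scale.
Proof.
elim/Lp_ind => f Lf.
by rewrite Lp_scaleE; apply: Lp_class_congr => t; rewrite !fctE scale1r.
Qed.

Lemma Lp_scaleDr : right_distributive Lp_scale +%R.
Proof.
move=> a; elim/Lp_ind => f Lf; elim/Lp_ind => g Lg.
rewrite [_ + _]Lp_addE !Lp_scaleE [RHS]Lp_addE.
by apply: Lp_class_congr => t; rewrite !fctE scalerDr.
Qed.

Lemma Lp_scaleDl (x : V) : {morph Lp_scale^~ x : a b / a + b}.
Proof.
move=> a b; elim/Lp_ind: x => f Lf.
rewrite !Lp_scaleE [RHS]Lp_addE.
by apply: Lp_class_congr => t; rewrite !fctE scalerDl.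
Qed.

HB.instance Definition _ := GRing.Zmodule_isLmodule.Build R[i] V
  Lp_scaleA Lp_scale1 Lp_scaleDr Lp_scaleDl.

Definition Lp_norm (x : V) : R[i] := (fine (Lpnorm mu p (Lp_fun x)))%:C.

Lemma ae_eq_Lpnorm f g : f \in Lp_pred mu p -> g \in Lp_pred mu p ->
  f = g %[ae mu] -> Lpnorm mu p f = Lpnorm mu p g.
Proof.
move=> /isLpP[f1 f2 _] /isLpP[g1 g2 _] fg; rewrite /Lpnorm unlock /=.
have mh (h : T -> R[i]) : measurable_fun setT (fun x => complex.Re (h x)) ->
    measurable_fun setT (fun x => complex.Im (h x)) ->
    measurable_fun setT (fun x => (`|rnorm (h x)| `^ p)%:E).
  move=> h1 h2; apply/measurable_EFinP.
  apply: (@measurableT_comp _ _ _ _ _ _ (@powR R ^~ p)) => //.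
  by apply: measurableT_comp => //; exact: measurable_rnorm.
congr (_ `^ _)%E; apply: ae_eq_integral => //; [exact: mh..|].
by apply: filterS fg => t /= fgt _; rewrite fgt.
Qed.

Lemma Lp_class_norm f (Lf : f \in Lp_pred mu p) :
  Lp_norm (Lp_class Lf) = (fine (Lpnorm mu p f))%:C.
Proof.
congr (fine _)%:C; apply: ae_eq_Lpnorm => //; first exact: Lp_funP.
exact: Lp_classK.
Qed.

Lemma Lpnorm_fin f : f \in Lp_pred mu p -> Lpnorm mu p f \is a fin_num.
Proof. by move=> /isLpP[_ _ Nf]; rewrite ge0_fin_numE// Lpnorm_ge0. Qed.

Lemma Lp_normD (x y : V) : Lp_norm (x + y) <= Lp_norm x + Lp_norm y.
Proof.
elim/Lp_ind: x => f Lf; elim/Lp_ind: y => g Lg.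
rewrite [_ + _]Lp_addE !Lp_class_norm -rmorphD lecR.
rewrite -lee_fin EFinD !fineK ?Lpnorm_fin//; last exact: Lp_predD.
by apply: (LpnormD p1); exact/isLpP.
Qed.

Lemma Lp_normZ (a : R[i]) (x : V) : Lp_norm (a *: x) = `|a| * Lp_norm x.
Proof.
elim/Lp_ind: x => f Lf.
rewrite [_ *: _]Lp_scaleE !Lp_class_norm rnormE -rmorphM; congr _%:C.
apply: EFin_inj; rewrite EFinM !fineK ?Lpnorm_fin//; last exact: Lp_predZ.
by apply: (LpnormZ p1); exact/isLpP.
Qed.

Lemma Lp_norm_eq0 (x : V) : Lp_norm x = 0 -> x = 0.
Proof.
elim/Lp_ind: x => f Lf; rewrite Lp_class_norm => /(congr1 (@complex.Re R)) /= Nf0.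
have {}Nf0 : Lpnorm mu p f = 0%E by rewrite -(fineK (Lpnorm_fin Lf)) Nf0.
have /isLpP[f1 f2 _] := Lf.
apply/Lp_class_eq.
have p0 : (0 < p%:E)%E by rewrite lte_fin (lt_le_trans _ p1).
have mf : measurable_fun setT (fun x => (rnorm (f x))%:E).
  by apply/measurable_EFinP; exact: measurable_rnorm.
apply: filterS (Lnorm_eq0_eq0 mf p0 Nf0) => t /= ft _.
by apply: rnorm_eq0; case: (ft I).
Qed.

HB.instance Definition _ :=
  Lmodule_isNormed.Build R[i] V Lp_normD Lp_normZ Lp_norm_eq0.

End Lp_space.

Section argument.
Context (R : realType).
Implicit Types (w : R) (z : R[i]).

(* The principal argument, in ]-pi, pi] (see argP); arg 0 is irrelevant. *)
Definition arg z : R :=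
  let t := acos (complex.Re z / rnorm z) in
  if 0 <= complex.Im z then t else - t.

Lemma mulcR (r a b : R) : r%:C * (a +i* b) = (r * a) +i* (r * b).
Proof. by simpc. Qed.

Lemma argP z : z != 0 ->
  - pi < arg z <= pi /\
  z = (rnorm z)%:C * (cos (arg z) +i* sin (arg z)).
Proof.
move=> z0; have n0 : 0 < rnorm z.
  by rewrite lt_neqAle rnorm_ge0 andbT eq_sym; apply: contra z0 => /eqP/rnorm_eq0->.
have n2 : rnorm z ^+ 2 = complex.Re z ^+ 2 + complex.Im z ^+ 2.
  by rewrite rnorm_sqrt sqr_sqrtr// addr_ge0 ?sqr_ge0.
have le1 : `|complex.Re z / rnorm z| <= 1.
  rewrite normrM normfV (gtr0_norm n0) ler_pdivrMr// mul1r.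
  by rewrite rnorm_sqrt -sqrtr_sqr ler_sqrt ?addr_ge0 ?sqr_ge0// lerDl sqr_ge0.
have in1 : -1 <= complex.Re z / rnorm z <= 1 by rewrite -ler_norml.
have si : sin (acos (complex.Re z / rnorm z)) = `|complex.Im z| / rnorm z.
  rewrite sin_acos// -[in RHS](gtr0_norm n0) -normfV -normrM -sqrtr_sqr.
  congr Num.sqrt; rewrite !exprMn !exprVn n2.
  have : complex.Re z ^+ 2 + complex.Im z ^+ 2 != 0 by rewrite -n2 expf_neq0 ?gt_eqF.
  by move: (complex.Re z) (complex.Im z) => a b ab; field.
have co : cos (acos (complex.Re z / rnorm z)) = complex.Re z / rnorm z.
  by rewrite acosK// in_itv.
rewrite /arg; case: ifPn => [i0|]; last rewrite -ltNge => i0.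
  split; first by rewrite acos_lepi// andbT (lt_le_trans _ (acos_ge0 in1))// oppr_lt0 pi_gt0.
  rewrite si co (ger0_norm i0) mulcR ![_ * (_ / _)]mulrC !divfK ?gt_eqF//.
  by case: (z).
split.
  rewrite ltrN2 (le_trans _ (pi_ge0 R)) ?oppr_le0 ?acos_ge0// andbT.
  rewrite lt_neqAle acos_lepi// andbT; apply: contra_ltN i0 => /eqP api.
  by move: si; rewrite api sinpi => /esym/eqP; rewrite mulf_eq0 invr_eq0 (gt_eqF n0) orbF normr_eq0 => /eqP ->.
rewrite sinN cosN si co (ltr0_norm i0) mulNr opprK mulcR.
by rewrite ![_ * (_ / _)]mulrC !divfK ?gt_eqF//; case: (z).
Qed.

(* R[i]^o carries the usual topology of the complex plane. For pi < w this is
   the punctured plane. *)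
Definition sector w : set R[i]^o := [set z | z != 0 /\ `|arg z| < w].

End argument.

(* Values of op_fun outside dom are irrelevant: all notions below depend only on
   the restriction of op_fun to dom. *)
Record operator (R : realType) (X : normedModType R[i]) := Operator {
  dom : set X;
  op_fun :> X -> X;
  dom0 : dom 0;
  dom_linear : forall (a : R[i]) x y, dom x -> dom y -> dom (a *: x + y);
  op_linear : forall (a : R[i]) x y, dom x -> dom y ->
    op_fun (a *: x + y) = a *: op_fun x + op_fun y }.

Section sectorial.
Context (R : realType) (X : normedModType R[i]).
Implicit Types (A : operator X) (T : X -> X) (l : R[i]) (w : R).

Definition closed_operator A : Prop :=
  closed [set xy : X * X | dom A xy.1 /\ xy.2 = A xy.1].

Definition densely_defined A : Prop := dense (dom A).

Definition dense_range A : Prop := dense (A @` dom A).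

Definition opnorm T : \bar R :=
  ereal_sup [set (rnorm (T x))%:E | x in [set x | rnorm x <= 1]].

(* R(l, A) is the inverse of l - A : dom A -> X; it is only meaningful when this
   map is bijective, in particular for l in the resolvent set. *)
Definition resolvent A l : X -> X :=
  'pinv_(fun=> 0) (dom A) (fun x => l *: x - A x).

Definition resolvent_set A : set R[i]^o :=
  [set l | set_bij (dom A) setT (fun x => l *: x - A x) /\
           continuous (resolvent A l)].

Definition spectrum A : set R[i]^o := ~` resolvent_set A.

Definition scaled_resolvents A w : set (X -> X) :=
  [set (fun x => l *: resolvent A l x) | l in ~` closure (sector w)].

(* The suprema are taken in the extended reals; the supremum over the empty set
   (when pi <= w + e) is -oo. *)
Definition sectorial_of_angle A w : Prop :=
  spectrum A `<=` closure (sector w) /\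
  forall e, 0 < e ->
    (ereal_sup [set opnorm T | T in scaled_resolvents A (w + e)] < +oo)%E.

Definition sectorial A : Prop :=
  [/\ closed_operator A, densely_defined A, dense_range A &
      exists w, 0 < w < pi /\ sectorial_of_angle A w].

Definition sectorial_angle A : R :=
  inf [set w | 0 < w < pi /\ sectorial_of_angle A w].

End sectorial.

(* Functions on [0,1] are represented by functions on the real line, up to
   equality almost everywhere for the Lebesgue measure restricted to [0,1]. *)
Definition lebesgue01 (R : realType) : {measure set (measurableTypeR R) -> \bar R} :=
  mrestr (@lebesgue_measure R) (measurable_itv `[0 : R, 1]).

Definition rademacher (R : realType) (k : nat) (t : R) : R :=
  Num.sg (sin (2 ^+ k * pi * t)).

Section R_boundedness.
Context (R : realType) (X : normedModType R[i]).

(* The norm of \sum_(1 <= k <= n) r_k x_k in L_q([0,1]; X). *)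
Definition rademacher_norm (q : R) (n : nat) (x : 'I_n -> X) : \bar R :=
  'N[lebesgue01 R]_(q%:E)[(fun t =>
    (rnorm (\sum_(k < n) (rademacher k.+1 t)%:C *: x k))%:E)]%E.

(* Applied only to families of bounded operators. As usual the T_k need not be
   pairwise distinct. *)
Definition R_bounded (F : set (X -> X)) : Prop :=
  exists2 q, 1 <= q & exists2 C, 0 <= C &
    forall (n : nat) (T : 'I_n -> X -> X) (x : 'I_n -> X),
      (forall k, F (T k)) ->
      (rademacher_norm q (fun k => T k (x k)) <= C%:E * rademacher_norm q x)%E.

Definition R_sectorial (A : operator X) : Prop :=
  exists w, sectorial_angle A < w < pi /\ R_bounded (scaled_resolvents A w).

End R_boundedness.

Lemma ge1_gt2 (R : realType) (p : R) : 2 < p -> 1 <= p.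
Proof. by move=> /ltW; apply: le_trans; rewrite ler1n. Qed.

(* Main.v *)
From HB Require Import structures.
Require Import Defs.
From mathcomp Require Import all_boot all_order all_algebra.
From mathcomp Require Import complex.
From mathcomp Require Import all_classical all_reals all_analysis.
From mathcomp Require Import measurable_realfun ring lra zify.

(** For p > 2 two kinds of normalised sequences in L_p behave differently under
random signs: signed sums of n disjoint functions x_1, ..., x_n have norm of
order n^(1/p), while signed sums of n independent signs r_1, ..., r_n have norm
of order at least sqrt n. The operator A couples the two. It has geometric
eigenvalues mu_j = 2^-j, with x_n + r_n an eigenvector for mu_(2n+1) and r_n an
eigenvector for mu_(2n+2), so that
  psi(A) x_n = psi(mu_(2n+1)) x_n + (psi(mu_(2n+1)) - psi(mu_(2n+2))) r_n.
For psi(z) = l / (l - z) with l = - mu_(2n+2) the coefficient of r_n is -1/6,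
whatever n is ([pole_gap]). If the family of all l R(l, A) were R-bounded, the
signed sums of the r_n would therefore be dominated by those of the x_n, that
is, sqrt n by n^(1/p).

Nevertheless each single operator psi(A) is bounded in terms of the supremum
and of the variation of psi along the sequence mu ([calc_lp_bound]). Indeed the
r_n are martingale differences for the conditional expectations C_n on {0,1}^m,
and Abel summation ([calc_abel]) writes psi(A) as a combination of contractions
of l_p whose coefficients are increments of psi. When l stays outside a sector,
psi(z) = l / (l - z) satisfies
|psi(a) - psi(b)| <= K (|l| / (|l| + a) - |l| / (|l| + b)) for 0 <= a <= b, and
the right-hand side telescopes along mu: the variation is bounded independently
of l ([bvar_resolvent]). This gives the uniform resolvent estimate in the
complement of every sector, hence sectorial angle 0. The calculus psi(A) is
multiplicative ([calc_mul]), which identifies the resolvents.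

To live on L_p([0,1]), the construction is split into finite blocks: block m
acts on functions on a finite index set containing m disjoint copies of {0,1}^m
for x_1, ..., x_m and one more copy carrying r_1, ..., r_m. The interval is cut
into countably many blocks, and block m into equal pieces labelled by its index
set. An operator on functions of the index then acts on L_p over each set of
points having the same position in their pieces; its norm is controlled on
these fibers, because the pieces are translates of each other
([integral_fiber], [Lpnorm_fiber_le]). On every block A is invertible, and
functions supported by finitely many blocks are dense, so that A has dense
range. *)

Set Implicit Arguments.
Unset Strict Implicit.
Unset Printing Implicit Defensive.

Import Order.TTheory GRing.Theory Num.Theory.
Import numFieldTopology.Exports numFieldNormedType.Exports.

Local Open Scope classical_set_scope.
Local Open Scope ring_scope.
Local Open Scope complex_scope.

(** * The complex modulus and convexity of powers *)

Section modulus.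
Context (R : realType).
Local Notation C := R[i].
Implicit Types (z : C) (r : R).

Lemma rnorm_sum (V : normedZmodType C) (J : Type) (s : seq J) (u : J -> V) :
  rnorm (\sum_(k <- s) u k) <= \sum_(k <- s) rnorm (u k).
Proof.
elim: s => [|k s IH]; first by rewrite !big_nil rnorm0.
by rewrite !big_cons (le_trans (ler_rnormD _ _))// lerD2l.
Qed.

Lemma rnorm_gt0 (V : normedZmodType C) (x : V) : x != 0 -> 0 < rnorm x.
Proof.
move=> x0; rewrite lt_neqAle rnorm_ge0 andbT eq_sym.
by apply: contra x0 => /eqP/rnorm_eq0->.
Qed.

Lemma rnormC r : rnorm (r%:C : C) = `|r|.
Proof. by rewrite rnorm_sqrt /= expr0n addr0 sqrtr_sqr. Qed.

Lemma rnorm1 : rnorm (1 : C) = 1.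
Proof. by rewrite rnorm_sqrt /= expr1n expr0n addr0 sqrtr1. Qed.

Lemma rnormV z : rnorm z^-1 = (rnorm z)^-1.
Proof.
have [->|z0] := eqVneq z 0; first by rewrite invr0 rnorm0 invr0.
have nz : rnorm z != 0 by rewrite gt_eqF// rnorm_gt0.
by apply: (mulfI nz); rewrite -rnormM (mulfV z0) (mulfV nz) rnorm1.
Qed.

Lemma rnorm_sqr z : rnorm z ^+ 2 = complex.Re z ^+ 2 + complex.Im z ^+ 2.
Proof. by rewrite rnorm_sqrt sqr_sqrtr// addr_ge0 ?sqr_ge0. Qed.

Lemma ler_Re_rnorm z : `|complex.Re z| <= rnorm z.
Proof. by rewrite rnorm_sqrt -sqrtr_sqr ler_wsqrtr// lerDl sqr_ge0. Qed.

Lemma Re_sum (J : Type) (s : seq J) (F : J -> C) :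
  complex.Re (\sum_(j <- s) F j) = \sum_(j <- s) complex.Re (F j).
Proof.
elim: s => [|j s IH]; rewrite ?big_nil// !big_cons -IH.
by case: (F j) (\sum_(_ <- _) _) => ? ? [].
Qed.

Lemma Im_sum (J : Type) (s : seq J) (F : J -> C) :
  complex.Im (\sum_(j <- s) F j) = \sum_(j <- s) complex.Im (F j).
Proof.
elim: s => [|j s IH]; rewrite ?big_nil// !big_cons -IH.
by case: (F j) (\sum_(_ <- _) _) => ? ? [].
Qed.

Lemma Re_realM r z : complex.Re (r%:C * z) = r * complex.Re z.
Proof. by case: z => a b /=; rewrite mul0r subr0. Qed.

Lemma Im_realM r z : complex.Im (r%:C * z) = r * complex.Im z.
Proof. by case: z => a b /=; rewrite mul0r addr0. Qed.

End modulus.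

Section jensen.
Context (R : realType).
Implicit Types p : R.

Lemma powR_convex2 p (a b x y : R) : 1 <= p -> 0 <= a -> 0 <= b ->
  0 <= x -> 0 <= y ->
  (a * x + b * y) `^ p <= (a + b) `^ (p - 1) * (a * x `^ p + b * y `^ p).
Proof.
move=> p1 a0 b0 x0 y0.
have [ab0|ab0] := eqVneq (a + b) 0.
  have [-> ->] : a = 0 /\ b = 0 by split; lra.
  by rewrite !mul0r !addr0 mulr0 powR0// gt_eqF// (lt_le_trans _ p1).
have abp : 0 < a + b by rewrite lt_neqAle eq_sym ab0 addr_ge0.
have t01 : 0 <= a / (a + b) <= 1.
  by rewrite divr_ge0 ?(ltW abp)//= ler_pdivrMr// mul1r lerDl.
have := @convex_powR R p p1 (Itv01 (andP t01).1 (andP t01).2) x y.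
rewrite !inE /= !in_itv /= !andbT => /(_ x0 y0).
rewrite convRE [X in X `^ _ <= _ -> _]convRE /= /unstable.onem.
have -> : (1 - a / (a + b)) = b / (a + b) by field.
have -> : a / (a + b) * x + b / (a + b) * y = (a * x + b * y) / (a + b) by field.
have -> : a / (a + b) * x `^ p + b / (a + b) * y `^ p
  = (a * x `^ p + b * y `^ p) / (a + b) by field.
rewrite powRM ?addr_ge0 ?mulr_ge0 ?invr_ge0 ?(ltW abp)//.
rewrite -powR_inv1 ?(ltW abp)// -powRrM mulN1r.
move=> h; have := ler_wpM2l (powR_ge0 (a + b) p) h.
rewrite mulrCA -powRD ?ab0 ?implybT// subrr powRr0 mulr1 => /le_trans; apply.
by rewrite mulrCA -powRD ?ab0 ?implybT// mulrC.
Qed.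

(** Jensen's inequality for x |-> x `^ p with weights of arbitrary total mass,
so that the total mass may vanish. *)
Lemma jensen_powR p (J : Type) (r : seq J) (w z : J -> R) : 1 <= p ->
  (forall k, 0 <= w k) -> (forall k, 0 <= z k) ->
  (\sum_(k <- r) w k * z k) `^ p <=
  (\sum_(k <- r) w k) `^ (p - 1) * \sum_(k <- r) w k * z k `^ p.
Proof.
move=> p1 w0 z0; have pgt0 : 0 < p by exact: lt_le_trans p1.
elim: r => [|k r IH]; first by rewrite !big_nil mulr0 powR0// gt_eqF.
rewrite !big_cons.
set W := \sum_(j <- r) w j in IH *; set S := \sum_(j <- r) w j * z j in IH *.
set Z := \sum_(j <- r) w j * z j `^ p in IH *.
have W0 : 0 <= W by exact: sumr_ge0.
have S0 : 0 <= S by apply: sumr_ge0 => j _; rewrite mulr_ge0.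
have [We0|Wn0] := eqVneq W 0.
  have SZ : S = 0 /\ Z = 0.
    rewrite /S /Z; move: We0; rewrite /W; elim: (r) => [|j s IHs].
      by rewrite !big_nil.
    rewrite !big_cons => js.
    have s0 : 0 <= \sum_(i <- s) w i by exact: sumr_ge0.
    have j0 := w0 j.
    have [wj ws] : w j = 0 /\ \sum_(i <- s) w i = 0 by split; lra.
    by have [-> ->] := IHs ws; rewrite wj !mul0r addr0.
  rewrite SZ.1 SZ.2 We0 !addr0.
  have := @powR_convex2 p (w k) 0 (z k) 0 p1 (w0 k) (lexx _) (z0 k) (lexx _).
  by rewrite !mul0r !addr0.
have Wp : 0 < W by rewrite lt_neqAle eq_sym Wn0.
have -> : S = W * (S / W) by field.
apply: (le_trans (powR_convex2 p1 (w0 k) W0 (z0 k) _)).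
  by rewrite divr_ge0.
rewrite ler_wpM2l ?powR_ge0// lerD2l.
have -> : W * (S / W) `^ p = S `^ p / W `^ (p - 1).
  rewrite powRM ?invr_ge0// -(powR_inv1 W0) -powRrM mulN1r mulrCA; congr (_ * _).
  by rewrite -[X in X * _](powRr1 W0) -powRD ?Wn0 ?implybT// -powRN opprB.
by rewrite ler_pdivrMr ?powR_gt0// mulrC.
Qed.

Lemma rnorm_comb_powR p (J : Type) (r : seq J) (c z : J -> R[i]) : 1 <= p ->
  rnorm (\sum_(k <- r) c k * z k) `^ p <=
  (\sum_(k <- r) rnorm (c k)) `^ (p - 1) *
    \sum_(k <- r) rnorm (c k) * rnorm (z k) `^ p.
Proof.
move=> p1; apply: le_trans (jensen_powR r p1 _ _); last 2 first.
- by move=> k; exact: rnorm_ge0.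
- by move=> k; exact: rnorm_ge0.
apply: ge0_ler_powR.
- by rewrite (le_trans _ p1).
- by rewrite nnegrE rnorm_ge0.
- by rewrite nnegrE sumr_ge0// => k _; rewrite mulr_ge0 ?rnorm_ge0.
by apply: (le_trans (rnorm_sum _ _)); apply: ler_sum => k _; rewrite rnormM.
Qed.

(** A combination of contractions of l_p has norm at most the sum of the moduli
of its coefficients. Applying Jensen's inequality with these moduli as weights
gives it directly in terms of p-th powers. *)
Lemma comb_contraction p (I : finType) (J : Type) (r : seq J) (c : J -> R[i])
    (z : J -> I -> R[i]) (N : R) : 1 <= p ->
  (forall k, \sum_i rnorm (z k i) `^ p <= N) ->
  \sum_i rnorm (\sum_(k <- r) c k * z k i) `^ p <=
  (\sum_(k <- r) rnorm (c k)) `^ p * N.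
Proof.
move=> p1 zN; have pgt0 : 0 < p by exact: lt_le_trans p1.
apply: (@le_trans _ _ (\sum_i (\sum_(k <- r) rnorm (c k)) `^ (p - 1) *
    \sum_(k <- r) rnorm (c k) * rnorm (z k i) `^ p)).
  by apply: ler_sum => i _; exact: rnorm_comb_powR.
have S0 : 0 <= \sum_(k <- r) rnorm (c k) by apply: sumr_ge0 => k _; exact: rnorm_ge0.
rewrite -mulr_sumr exchange_big /=.
rewrite -(mulr_powRB1 S0 pgt0) [X in _ <= X * _]mulrC -mulrA.
rewrite ler_wpM2l ?powR_ge0// mulr_suml; apply: ler_sum => k _.
by rewrite -mulr_sumr ler_wpM2l// rnorm_ge0.
Qed.

End jensen.

(** * Conditional expectations on the discrete cube *)

Section cube.
Context (m : nat).

Definition cube := {ffun 'I_m -> bool}.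
Implicit Types (w e : cube) (n : nat).

Definition mix n w e : cube := [ffun i : 'I_m => if (i < n)%N then w i else e i].

Lemma mix_mixr n k w e e' : (k <= n)%N -> mix k w (mix n e e') = mix n (mix k w e) e'.
Proof.
move=> kn; apply/ffunP => i; rewrite !ffunE.
by case: (ltnP i k) => // ik; rewrite (leq_trans ik kn).
Qed.

Lemma mix_mixl n k w e e' : (n <= k)%N -> mix n (mix k w e) e' = mix n w e'.
Proof.
move=> nk; apply/ffunP => i; rewrite !ffunE.
by case: (ltnP i n) => // ik; rewrite (leq_trans ik nk).
Qed.

Lemma mix_full w e : mix m w e = w.
Proof. by apply/ffunP => i; rewrite !ffunE ltn_ord. Qed.

Lemma mix_0 w e : mix 0 w e = e.
Proof. by apply/ffunP => i; rewrite !ffunE. Qed.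

Lemma card_cube : #|{: cube}| = (2 ^ m)%N.
Proof. by rewrite card_ffun card_bool card_ord. Qed.

(** Exchanging the digits of w and e from rank n on is an involution of the
pairs (w, e), and [mix n w e] is the first component of the result. *)
Lemma sum_mix (V : nmodType) n (g : cube -> V) :
  \sum_w \sum_e g (mix n w e) = (\sum_w g w) *+ 2 ^ m.
Proof.
rewrite pair_big /=.
pose h (we : cube * cube) : cube * cube := (mix n we.1 we.2, mix n we.2 we.1).
have hK : involutive h.
  by move=> [w e]; congr (_, _); apply/ffunP => i; rewrite /= !ffunE;
    case: (ltnP i n).
rewrite (reindex_inj (inv_inj hK)) /=.
rewrite (eq_bigr (fun we : cube * cube => g we.1)); last first.
  by move=> [w e] _; congr g; exact: (congr1 fst (hK (w, e))).
rewrite -(pair_big xpredT xpredT (fun w (e : cube) => g w)) /= -sumrMnl.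
by apply: eq_bigr => w _; rewrite sumr_const -card_cube.
Qed.

Definition flip (k : 'I_m) w : cube := [ffun i : 'I_m => if i == k then ~~ w i else w i].

Lemma flipK k : involutive (flip k).
Proof. by move=> w; apply/ffunP => i; rewrite !ffunE; case: eqP => // _; rewrite negbK. Qed.

Context (R : realType).
Local Notation C := R[i].

Lemma sum_flip0 k (g : cube -> C) : (forall w, g (flip k w) = - g w) -> \sum_w g w = 0.
Proof.
move=> gk; have : \sum_w g w = - \sum_w g w.
  rewrite {1}(reindex_inj (inv_inj (flipK k))) /= -sumrN.
  by apply: eq_bigr => w _.
by move=> /eqP; rewrite -addr_eq0 -mulr2n mulrn_eq0 /= => /eqP.
Qed.

(** Conditional expectation with respect to the first n digits. *)
Definition cond_exp n (y : cube -> C) : cube -> C :=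
  fun w => (2 ^+ m)^-1 * \sum_e y (mix n w e).

Lemma cond_exp_is_linear n : linear (cond_exp n).
Proof.
move=> a x y; apply/funext => w; rewrite !fctE /cond_exp /=.
by rewrite big_split /= -scaler_sumr mulrDr; congr (_ + _); rewrite /GRing.scale /= mulrCA.
Qed.
HB.instance Definition _ n :=
  GRing.isLinear.Build C (cube -> C) (cube -> C) _ (cond_exp n) (cond_exp_is_linear n).

Lemma two_neq0 : (2 ^+ m : C) != 0.
Proof. by rewrite expf_neq0// pnatr_eq0. Qed.

Lemma sum_cst_cube (c : C) : (2 ^+ m)^-1 * \sum_(e : cube) c = c.
Proof. by rewrite sumr_const card_cube -[c *+ _]mulr_natl natrX mulKf// two_neq0. Qed.

Lemma cond_exp_full y : cond_exp m y = y.
Proof.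
apply/funext => w; rewrite /cond_exp; under eq_bigr do rewrite mix_full.
exact: sum_cst_cube.
Qed.

(** The tower property. *)
Lemma cond_exp_comp k n y : cond_exp k (cond_exp n y) = cond_exp (minn k n) y.
Proof.
apply/funext => w; case: (leqP k n) => kn.
  rewrite {1}/cond_exp -mulr_sumr.
  under eq_bigr do under eq_bigr do rewrite -mix_mixr//.
  rewrite (sum_mix n (fun e => y (mix k w e))) -[X in _ * (_ * X)]mulr_natl natrX mulKf//.
rewrite {1}/cond_exp /cond_exp.
under eq_bigr do under eq_bigr do rewrite (mix_mixl _ _ _ (ltnW kn)).
exact: sum_cst_cube.
Qed.

Lemma cond_exp_contraction p n y : 1 <= p ->
  \sum_w rnorm (cond_exp n y w) `^ p <= \sum_w rnorm (y w) `^ p.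
Proof.
move=> p1; have pgt0 : 0 < p by exact: lt_le_trans p1.
have S1 : \sum_(e : cube) rnorm ((2 ^+ m)^-1 : C) = 1.
  have -> : (2 ^+ m)^-1 = ((2 ^+ m)^-1 : R)%:C :> C.
    by rewrite fmorphV rmorphXn /= rmorph_nat.
  rewrite sumr_const card_cube rnormC ger0_norm ?invr_ge0 ?exprn_ge0//.
  by rewrite -[_ *+ _ ^ _]mulr_natl natrX mulfV// expf_neq0// pnatr_eq0.
have -> : \sum_w rnorm (cond_exp n y w) `^ p =
  \sum_w rnorm (\sum_(e : cube) (2 ^+ m)^-1 * y (mix n w e)) `^ p.
  by apply: eq_bigr => w _; rewrite /cond_exp mulr_sumr.
apply: (@le_trans _ _ (\sum_w \sum_e rnorm ((2 ^+ m)^-1 : C) * rnorm (y (mix n w e)) `^ p)).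
  apply: ler_sum => w _; apply: (le_trans (rnorm_comb_powR _ _ _ p1)).
  by rewrite S1 powR1 mul1r.
rewrite (sum_mix n (fun w => rnorm ((2 ^+ m)^-1 : C) * rnorm (y w) `^ p)).
rewrite -mulr_sumr -mulrnAl.
move: S1; rewrite sumr_const card_cube => ->.
by rewrite mul1r.
Qed.

Definition digit_sign (k : 'I_m) : cube -> C := fun w => (-1) ^+ w k.

Lemma digit_sign_flip k l w :
  digit_sign l (flip k w) = (if l == k then - digit_sign l w else digit_sign l w).
Proof.
rewrite /digit_sign ffunE; case: eqP => // _.
by case: (w l); rewrite /= ?expr0 ?expr1 ?opprK.
Qed.

Lemma cond_exp_digit_sign n k :
  cond_exp n (digit_sign k) = if (k < n)%N then digit_sign k else 0.
Proof.
apply/funext => w; rewrite /cond_exp; case: ifPn => kn.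
  under eq_bigr do rewrite /digit_sign ffunE kn.
  exact: sum_cst_cube.
rewrite (@sum_flip0 k) ?mulr0// => e.
rewrite /digit_sign !ffunE (negbTE kn) eqxx.
by case: (e k); rewrite /= ?expr0 ?expr1 ?opprK.
Qed.

Lemma rnorm_digit_sign k w : rnorm (digit_sign k w) = 1.
Proof. by rewrite /rnorm /digit_sign normrX normrN1 expr1n. Qed.

Lemma sum_digit_sign_neq k l : k != l -> \sum_w digit_sign k w * digit_sign l w = 0.
Proof.
move=> kl; apply: (@sum_flip0 k) => w; rewrite !digit_sign_flip eqxx eq_sym (negbTE kl).
by rewrite mulNr.
Qed.

End cube.

(** * The functional calculus of one block *)

Section block_calculus.
Context (R : realType) (m : nat).
Local Notation C := R[i].
Local Notation cube := (cube m).

Definition block_index := (option 'I_m * cube)%type.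
Implicit Types (y : block_index -> C) (phi psi : nat -> C) (u : cube -> C).

(** The conditional expectations shifted by one rank and preceded by 0, so that
all martingale differences, including the first, have the same form. *)
Definition prev_cond_exp j (u : cube -> C) : cube -> C :=
  if j is j'.+1 then cond_exp j' u else 0.
Lemma prev_cond_exp_is_linear j : linear (prev_cond_exp j).
Proof.
case: j => [|j] /=; last exact: cond_exp_is_linear.
by move=> a x y; rewrite /= scaler0 addr0.
Qed.
HB.instance Definition _ j :=
  GRing.isLinear.Build C (cube -> C) (cube -> C) _ (prev_cond_exp j) (prev_cond_exp_is_linear j).

Lemma prev_cond_exp_comp k n u :
  prev_cond_exp k (prev_cond_exp n u) = prev_cond_exp (minn k n) u.
Proof.
case: k => [|k]; first by rewrite min0n.
case: n => [|n]; first by rewrite minn0 linear0.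
by rewrite minnSS /= cond_exp_comp.
Qed.

Definition mart_diff j (u : cube -> C) : cube -> C :=
  prev_cond_exp j.+1 u - prev_cond_exp j u.
Lemma mart_diff_is_linear j : linear (mart_diff j).
Proof.
move=> a x y; rewrite /mart_diff (prev_cond_exp_is_linear j.+1) (prev_cond_exp_is_linear j).
by rewrite scalerBr opprD addrACA.
Qed.
HB.instance Definition _ j :=
  GRing.isLinear.Build C (cube -> C) (cube -> C) _ (mart_diff j) (mart_diff_is_linear j).

Lemma mart_diff_comp i j u :
  mart_diff i (mart_diff j u) = if i == j then mart_diff j u else 0.
Proof.
have cB k x z : prev_cond_exp k (x - z) = prev_cond_exp k x - prev_cond_exp k z by exact: raddfB.
rewrite /mart_diff !cB !prev_cond_exp_comp.
case: eqP => [->|/eqP ij].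
  by rewrite !minnn (minn_idPl (leqnSn j)) (minn_idPr (leqnSn j)) subrr subr0.
have [[-> ->]|[-> ->]] : minn i.+1 j = minn i j /\ minn i.+1 j.+1 = minn i j.+1 \/
    minn i.+1 j.+1 = minn i.+1 j /\ minn i j.+1 = minn i j by lia.
  by rewrite subrr.
by rewrite !subrr.
Qed.

Lemma mart_diff_digit_sign j (k : 'I_m) :
  mart_diff j (digit_sign R k) = if j == k.+1 then digit_sign R k else 0.
Proof.
rewrite /mart_diff; case: j => [|j] /=.
  by rewrite cond_exp_digit_sign ltn0 subr0.
rewrite !cond_exp_digit_sign eqSS; case: (ltngtP k j) => kj.
- by rewrite ltnS ltnW// subrr.
- by rewrite ltnS leqNgt kj subr0.
- by rewrite kj ltnSn subr0.
Qed.

Definition mean u : C := (2 ^+ m)^-1 * \sum_e u e.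

Lemma mean_cond_exp u w : mean u = cond_exp 0 u w.
Proof. by rewrite /mean /cond_exp; under [in RHS]eq_bigr do rewrite mix_0. Qed.

Lemma mean_linear a u v : mean (a *: u + v) = a * mean u + mean v.
Proof.
have w : cube := [ffun=> false].
by rewrite !(mean_cond_exp _ w) cond_exp_is_linear.
Qed.

(** The component of psi(A) y on the copy of the cube that carries the signs,
where phi_j is the value of psi at the eigenvalue of index j. The factor
phi_(2n+1) - phi_(2n+2) is the one for which x_n + r_n is an eigenvector for the
eigenvalue of index 2n+1, and it makes the calculus multiplicative. *)
Definition calc_corner phi y : cube -> C :=
  \sum_(j < m.+1) phi j.*2 *: mart_diff j (fun e => y (None, e)) +
  \sum_(n < m) ((phi n.*2.+1 - phi n.*2.+2) * mean (fun e => y (Some n, e))) *: digit_sign R n.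

Definition calc phi y : block_index -> C := fun i => match i with
  | (Some n, w) => phi n.*2.+1 * y (Some n, w)
  | (None, w) => calc_corner phi y w
  end.

Lemma calc_corner_linear phi a x y :
  calc_corner phi (a *: x + y) = a *: calc_corner phi x + calc_corner phi y.
Proof.
rewrite /calc_corner scalerDr addrACA !scaler_sumr -!big_split /=; congr (_ + _).
  apply: eq_bigr => j _.
  rewrite (_ : (fun e => _) = a *: (fun e => x (None, e)) + (fun e => y (None, e)))//.
  by rewrite mart_diff_is_linear scalerDr !scalerA mulrC.
apply: eq_bigr => n _.
rewrite (_ : (fun e => _) = a *: (fun e => x (Some n, e)) + (fun e => y (Some n, e)))//.
by rewrite mean_linear scalerA -scalerDl; congr (_ *: _); ring.
Qed.

Lemma calc_linear phi a x y : calc phi (a *: x + y) = a *: calc phi x + calc phi y.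
Proof.
apply/funext => -[[n|] w]; rewrite /calc; last by rewrite calc_corner_linear.
by rewrite !fctE mulrDr /GRing.scale /= mulrCA.
Qed.

(** The martingale differences are orthogonal idempotents and the sign r_n lies
in the range of the difference of rank n + 1; hence the coupling terms combine
by phi_(2n+2) (psi_(2n+1) - psi_(2n+2)) + (phi_(2n+1) - phi_(2n+2)) psi_(2n+1)
= phi_(2n+1) psi_(2n+1) - phi_(2n+2) psi_(2n+2). *)
Lemma calc_corner_mul phi psi y :
  calc_corner phi (calc psi y) = calc_corner (fun j => phi j * psi j) y.
Proof.
have mdD i x z : mart_diff i (x + z) = mart_diff i x + mart_diff i z by exact: linearD.
have mdZ i a x : mart_diff i (a *: x) = a *: mart_diff i x by exact: linearZ.
have md_sum i n (F : 'I_n -> cube -> C) : mart_diff i (\sum_j F j) = \sum_j mart_diff i (F j).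
  exact: linear_sum.
rewrite {1}/calc_corner (_ : (fun e => calc psi y (None, e)) = calc_corner psi y)//.
have -> : \sum_(j < m.+1) phi j.*2 *: mart_diff j (calc_corner psi y)
  = \sum_(j < m.+1) (phi j.*2 * psi j.*2) *: mart_diff j (fun e => y (None, e)) +
    \sum_(n < m) (phi n.*2.+2 * ((psi n.*2.+1 - psi n.*2.+2) * mean (fun e => y (Some n, e)))) *: digit_sign R n.
  under eq_bigr => j _.
    rewrite /calc_corner mdD !md_sum /= scalerDr.
    rewrite (bigD1 j)//= mdZ mart_diff_comp eqxx big1 ?addr0; last first.
      move=> i ij; rewrite mdZ mart_diff_comp.
      by rewrite [X in if X then _ else _](_ : _ = false) ?scaler0//; apply/negbTE; rewrite eq_sym.
    rewrite scalerA; over.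
  rewrite big_split /=; congr (_ + _).
  under eq_bigr do rewrite scaler_sumr.
  rewrite exchange_big /=; apply: eq_bigr => n _.
  have np : (n.+1 < m.+1)%N by rewrite ltnS.
  rewrite (bigD1 (Ordinal np))//= mdZ mart_diff_digit_sign eqxx big1 ?addr0; last first.
    move=> i ij; rewrite mdZ mart_diff_digit_sign.
    by rewrite [X in if X then _ else _](_ : _ = false) ?scaler0//; apply/negbTE.
  by rewrite scalerA doubleS.
rewrite -addrA -big_split /=; congr (_ + _); apply: eq_bigr => n _.
rewrite -scalerDl; congr (_ *: _).
have -> : mean (fun e => psi n.*2.+1 * y (Some n, e)) = psi n.*2.+1 * mean (fun e => y (Some n, e)).
  by rewrite /mean -mulr_sumr mulrCA.
by ring.
Qed.

Lemma calc_mul phi psi y : calc phi (calc psi y) = calc (fun j => phi j * psi j) y.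
Proof.
by apply/funext => -[[n|] w]; rewrite /= ?mulrA// calc_corner_mul.
Qed.

Lemma calc_corner_lin phi psi a y :
  calc_corner (fun j => a * phi j + psi j) y = a *: calc_corner phi y + calc_corner psi y.
Proof.
rewrite /calc_corner scalerDr addrACA !scaler_sumr -!big_split /=; congr (_ + _).
  by apply: eq_bigr => j _; rewrite scalerDl scalerA.
apply: eq_bigr => n _.
by rewrite scalerA -scalerDl; congr (_ *: _); ring.
Qed.

Lemma calc_lin_comb phi psi a y :
  calc (fun j => a * phi j + psi j) y = a *: calc phi y + calc psi y.
Proof.
apply/funext => -[[n|] w]; rewrite /calc; last by rewrite calc_corner_lin.
by rewrite !fctE mulrDl /GRing.scale /= mulrA.
Qed.

Lemma calc1 y : calc (fun=> 1) y = y.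
Proof.
apply/funext => -[[n|] w] /=; first by rewrite mul1r.
rewrite /calc_corner [X in _ + X]big1 ?addr0; last by move=> n _; rewrite subrr mul0r scale0r.
under eq_bigr do rewrite scale1r /mart_diff.
rewrite -(big_mkord xpredT (fun j => prev_cond_exp j.+1 _ - prev_cond_exp j _)) telescope_sumr//.
by rewrite /= subr0 cond_exp_full.
Qed.

Lemma abel_mart_diff phi u w k :
  \sum_(j < k.+1) phi j.*2 * mart_diff j u w =
  \sum_(j < k) (phi j.*2 - phi j.*2.+2) * cond_exp j u w + phi k.*2 * cond_exp k u w.
Proof.
elim: k => [|k IH].
  by rewrite big_ord_recl !big_ord0 addr0 add0r /mart_diff /= subr0.
rewrite big_ord_recr IH [in RHS]big_ord_recr /= /mart_diff !fctE /= doubleS.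
by ring.
Qed.

(** Abel summation trades the martingale differences for the conditional
expectations, which are contractions. *)
Lemma calc_abel phi y w : calc phi y (None, w) =
  \sum_(j < m) (phi j.*2 - phi j.*2.+2) * cond_exp j (fun e => y (None, e)) w +
  phi m.*2 * y (None, w) +
  \sum_(n < m) (phi n.*2.+1 - phi n.*2.+2) * (digit_sign R n w * cond_exp 0 (fun e => y (Some n, e)) w).
Proof.
rewrite /= /calc_corner !fctE; congr (_ + _); last first.
  rewrite fct_sumE; apply: eq_bigr => n _; rewrite -mean_cond_exp.
  by rewrite -[LHS]/(_ * _ * digit_sign R n w) -mulrA; congr (_ * _); exact: mulrC.
rewrite fct_sumE; set u := fun e => y (None, e).
have := abel_mart_diff phi u w m; rewrite cond_exp_full => <-.
by apply: eq_bigr.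
Qed.

Lemma sum_block_index (V : nmodType) (g : block_index -> V) :
  \sum_i g i = \sum_w g (None, w) + \sum_n \sum_w g (Some n, w).
Proof.
transitivity (\sum_(o : option 'I_m) \sum_(w : cube) g (o, w)).
  by rewrite pair_bigA; apply: eq_bigr => -[].
rewrite (bigD1 None)//=; congr (_ + _).
rewrite (reindex_omap (@Some _) id)/=; last by case.
by apply: eq_bigl => n; rewrite eqxx.
Qed.

(** By [calc_abel] the corner component is a combination of contractions with
total mass at most V, and the other components are multiplied by values of
phi. *)
Lemma calc_lp_bound p phi y (S V : R) : 1 <= p -> 
  (forall j, (j <= m.*2)%N -> rnorm (phi j) <= S) ->
  \sum_(j < m) rnorm (phi j.*2 - phi j.*2.+2) + rnorm (phi m.*2) +
    \sum_(j < m) rnorm (phi j.*2.+1 - phi j.*2.+2) <= V ->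
  \sum_i rnorm (calc phi y i) `^ p <= (V `^ p + S `^ p) * \sum_i rnorm (y i) `^ p.
Proof.
move=> p1 phiS phiV; have pgt0 : 0 < p by exact: lt_le_trans p1.
have S0 : 0 <= S by exact: le_trans (rnorm_ge0 _) (phiS 0 _).
set N := \sum_i rnorm (y i) `^ p.
have N0 : 0 <= N by apply: sumr_ge0 => i _; exact: powR_ge0.
have NE := sum_block_index (fun i => rnorm (y i) `^ p); rewrite -/N /= in NE.
rewrite sum_block_index mulrDl lerD//; last first.
  apply: (@le_trans _ _ (\sum_n \sum_w S `^ p * rnorm (y (Some n, w)) `^ p)).
    apply: ler_sum => n _; apply: ler_sum => w _ /=.
    rewrite rnormM powRM ?rnorm_ge0//.
    rewrite ler_wpM2r ?powR_ge0// ge0_ler_powR ?nnegrE ?rnorm_ge0 ?(ltW pgt0)//.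
    by rewrite phiS// ltn_double ltn_ord.
  under eq_bigr do rewrite -mulr_sumr.
  rewrite -mulr_sumr ler_wpM2l ?powR_ge0// NE lerDr.
  by apply: sumr_ge0 => w _; exact: powR_ge0.
(* The three groups of terms of the Abel form, indexed by a sum type. *)
pose c (k : 'I_m + (unit + 'I_m)) : C := match k with
  | inl j => phi j.*2 - phi j.*2.+2
  | inr (inl _) => phi m.*2
  | inr (inr n) => phi n.*2.+1 - phi n.*2.+2 end.
pose z (k : 'I_m + (unit + 'I_m)) (w : cube) : C := match k with
  | inl j => cond_exp j (fun e => y (None, e)) w
  | inr (inl _) => y (None, w)
  | inr (inr n) => digit_sign R n w * cond_exp 0 (fun e => y (Some n, e)) w end.
rewrite (eq_bigr (fun w => rnorm (\sum_k c k * z k w) `^ p)); last first.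
  move=> w _; congr (rnorm _ `^ p); rewrite calc_abel big_sumType /= -addrA.
  by congr (_ + _); rewrite big_sumType /= (big_pred1 tt)//; case.
have zN k : \sum_w rnorm (z k w) `^ p <= N.
  have h0 : \sum_w rnorm (y (None, w)) `^ p <= N.
    rewrite NE lerDl; apply: sumr_ge0 => n _; apply: sumr_ge0 => w _; exact: powR_ge0.
  case: k => [j|[[]|n]] //=; first by apply: (le_trans (cond_exp_contraction _ _ p1)).
  under eq_bigr do rewrite rnormM rnorm_digit_sign mul1r.
  apply: (le_trans (cond_exp_contraction _ _ p1)).
  rewrite NE (bigD1 n)//= addrCA lerDl addr_ge0// ?sumr_ge0// => *; rewrite ?powR_ge0//.
  by rewrite sumr_ge0// => *; rewrite powR_ge0.
apply: (le_trans (comb_contraction _ _ p1 zN)).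
rewrite ler_wpM2r// ge0_ler_powR ?(ltW pgt0)// ?nnegrE.
- by apply: sumr_ge0 => k _; exact: rnorm_ge0.
- apply: le_trans phiV; rewrite !addr_ge0 ?rnorm_ge0 ?sumr_ge0// => *; exact: rnorm_ge0.
apply: le_trans phiV; rewrite big_sumType /= -addrA lerD2l big_sumType /=.
by rewrite (big_pred1 tt)//; case.
Qed.

End block_calculus.

(** * Cutting the unit interval into blocks of equal pieces *)

Section pieces.
Context (R : realType) (I : nat -> finType) (I0 : forall m, (0 < #|I m|)%N).
Local Notation leb := (@lebesgue_measure R).

Definition cut m : R := m.+1%:R^-1.
Definition len m : R := (cut m - cut m.+1) / #|I m|%:R.
Definition lo m (i : I m) : R := cut m.+1 + (enum_rank i)%:R * len m.
Definition piece m (i : I m) : set R := `[lo i, lo i + len m[%classic.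
Definition block m : set R := `[cut m.+1, cut m[%classic.

Lemma cut_gt0 m : 0 < cut m. Proof. by rewrite /cut invr_gt0 ltr0n. Qed.

Lemma cut_le m n : (m <= n)%N -> cut n <= cut m.
Proof. by move=> mn; rewrite /cut lef_pV2 ?posrE ?ltr0n// ler_nat ltnS. Qed.

Lemma cut_lt m : cut m.+1 < cut m.
Proof. by rewrite /cut ltf_pV2 ?posrE ?ltr0n// ltr_nat ltnS. Qed.

Lemma cardI_gt0 m : 0 < #|I m|%:R :> R. Proof. by rewrite ltr0n. Qed.

Lemma len_gt0 m : 0 < len m.
Proof. by rewrite /len divr_gt0 ?cardI_gt0// subr_gt0 cut_lt. Qed.

Lemma card_len m : #|I m|%:R * len m = cut m - cut m.+1.
Proof. by rewrite /len mulrC divfK// gt_eqF// cardI_gt0. Qed.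

Lemma pieceP m (i : I m) s : piece i s <-> exists2 t, 0 <= t < len m & s = lo i + t.
Proof.
rewrite /piece /= in_itv /=; split => [/andP[a b]|[t /andP[a b] ->]].
  by exists (s - lo i); [rewrite subr_ge0 a/= ltrBlDl | rewrite subrKC].
by rewrite lerDl a ltrD2l.
Qed.

Lemma piece_block m (i : I m) : piece i `<=` block m.
Proof.
move=> s /pieceP[t /andP[t0 tl] ->]; rewrite /block /= in_itv /= /lo; apply/andP; split.
  by rewrite -addrA lerDl addr_ge0// mulr_ge0// ltW// len_gt0.
rewrite -(subrKC (cut m.+1) (cut m)) -card_len -addrA ltrD2l.
apply: (@lt_le_trans _ _ ((enum_rank i)%:R * len m + 1 * len m)).
  by rewrite mul1r ltrD2l.
rewrite -mulrDl ler_wpM2r ?(ltW (len_gt0 m))//.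
by rewrite natr1 ler_nat; exact: ltn_ord.
Qed.

Lemma block_inj m n s : block m s -> block n s -> m = n.
Proof.
rewrite /block /= !in_itv /= => /andP[a b] /andP[c d].
case: (ltngtP m n) => // mn.
- by have := lt_le_trans d (cut_le mn); rewrite ltNge a.
- by have := lt_le_trans b (cut_le mn); rewrite ltNge c.
Qed.

Lemma piece_inj m (i j : I m) s : piece i s -> piece j s -> i = j.
Proof.
wlog: i j / (enum_rank i <= enum_rank j)%N => [H|ij] pi pj.
  have [ij|ij] := leqP (enum_rank i) (enum_rank j); first exact: H.
  by apply/esym; apply: H => //; exact: ltnW.
apply: enum_rank_inj; apply/val_inj/eqP => /=; rewrite eqn_leq ij /= leqNgt.
apply/negP => lt_ij; move: pi pj; rewrite /piece /= !in_itv /= => /andP[_ b] /andP[c _].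
have := le_lt_trans c b; rewrite /lo ltNge => /negP; apply.
rewrite -addrA lerD2l -[X in _ + X]mul1r -mulrDl ler_wpM2r ?(ltW (len_gt0 m))//.
by rewrite natr1 ler_nat.
Qed.

Lemma block_piece m s : block m s -> exists i : I m, piece i s.
Proof.
rewrite /block /= in_itv /= => /andP[a b].
set x := (s - cut m.+1) / len m.
have x0 : 0 <= x by rewrite divr_ge0 ?subr_ge0// ltW// len_gt0.
have xN : x < #|I m|%:R.
  by rewrite /x ltr_pdivrMr ?len_gt0// card_len ltrD2r.
have /andP[k1 k2] := truncn_itv x0.
have kN : (Num.truncn x < #|I m|)%N by rewrite -(ltr_nat R) (le_lt_trans k1).
exists (enum_val (Ordinal kN)); rewrite /piece /= in_itv /= /lo enum_valK /=.
have sE : s = cut m.+1 + x * len m by rewrite /x divfK ?subrKC// gt_eqF// len_gt0.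
rewrite {1 2}sE; apply/andP; split.
  by rewrite lerD2l ler_wpM2r// ltW// len_gt0.
rewrite -addrA ltrD2l -[X in _ < _ + X]mul1r -mulrDl ltr_pM2r ?len_gt0//.
by rewrite natr1.
Qed.

Lemma blockE m : block m = \big[setU/set0]_(i <- enum (I m)) piece i.
Proof.
apply/seteqP; split => s; last first.
  by rewrite -bigcup_seq => -[i _]; exact: piece_block.
by move=> /block_piece[i pi]; rewrite -bigcup_seq; exists i => //=; rewrite mem_enum.
Qed.

Lemma bigcup_block : \bigcup_m block m = `]0, 1[%classic.
Proof.
apply/seteqP; split => s.
  move=> [m _]; rewrite /block /= !in_itv /= => /andP[a b].
  rewrite (lt_le_trans (cut_gt0 _) a)/= (lt_le_trans b)//.
  by have := cut_le (leq0n m); rewrite /cut invr1.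
rewrite /= in_itv /= => /andP[s0 s1].
have ex : exists n, cut n <= s.
  exists (Num.truncn s^-1); rewrite /cut -[s in _ <= s]invrK lef_pV2 ?posrE ?ltr0n ?invr_gt0//.
  by rewrite ltW// truncnS_gt.
(* The first cut not above s is the left end of a block, since cut 0 = 1 > s. *)
case: (ex_minnP ex) => -[|n] ns nmin; first by move: ns; rewrite /cut invr1 leNgt s1.
exists n => //; rewrite /block /= in_itv /= ns /= ltNge; apply/negP => /nmin.
by rewrite ltnn.
Qed.

Definition piece_label s : option {m : nat & I m} :=
  if pselect (exists mi : {m : nat & I m}, piece (tagged mi) s) is left e
  then Some (projT1 (cid e)) else None.

Lemma piece_labelE m (i : I m) s : piece i s -> piece_label s = Some (Tagged I i).
Proof.
move=> pis; rewrite /piece_label; case: pselect => [e|]; last first.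
  by case; exists (Tagged I i).
congr Some; case: (cid e) => -[n j] /= pjs.
have nm := block_inj (piece_block pjs) (piece_block pis).
by subst n; rewrite (piece_inj pjs pis).
Qed.

Lemma piece_labelP s mi : piece_label s = Some mi -> piece (tagged mi) s.
Proof. by rewrite /piece_label; case: pselect => // e [<-]; case: (cid e). Qed.

Lemma measurable_piece m (i : I m) : measurable (piece i).
Proof. exact: measurable_itv. Qed.

Lemma measurable_pieces (g : measurableTypeR R -> R)
    (G : forall m, I m -> measurableTypeR R -> R) :
  (forall m i, measurable_fun setT (@G m i)) ->
  (forall m i s, piece i s -> g s = @G m i s) ->
  (forall s, piece_label s = None -> g s = 0) -> measurable_fun setT g.
Proof.
move=> mG gG g0.
pose F k : set R := if @unpickle {m : nat & I m} k is Some mi then piece (tagged mi) else set0.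
have mF k : measurable (F k) by rewrite /F; case: unpickle => // mi; exact: measurable_piece.
have mUF : measurable (\bigcup_k F k) by exact: bigcup_measurable.
rewrite -(setUv (\bigcup_k F k)); apply/measurable_funU => //; first exact: measurableC.
split.
  apply/measurable_fun_bigcup => // k; rewrite /F; case: unpickle => [mi|]; last first.
    exact: measurable_fun_set0.
  apply: (eq_measurable_fun (G (tag mi) (tagged mi))).
    by move=> s; rewrite inE => /gG ->.
  exact: measurable_funS (mG _ _).
apply: (@eq_measurable_fun _ _ _ _ _ (cst (0 : R))) => // s; rewrite inE => sF; apply/esym/g0.
case E : (piece_label s) => [mi|] //; exfalso; apply: sF; exists (pickle mi) => //.
by rewrite /F pickleK; exact: piece_labelP E.
Qed.

Lemma integral_translate (g : R -> \bar R) a h : measurable_fun setT g ->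
  (forall x, 0 <= g x)%E ->
  (\int[leb]_(x in `[a, (a + h)%R[) g x = \int[leb]_(t in `[0%R, h[) g (a + t)%R)%E.
Proof.
move=> mg g0.
have mphi : measurable_fun setT ((fun t => a + t) : measurableTypeR R -> measurableTypeR R).
  by apply: measurable_funD => //; exact: measurable_cst.
have -> : `[0, h[%classic = ((fun t => a + t) : measurableTypeR R -> measurableTypeR R) @^-1` `[a, a + h[.
  by apply/seteqP; split => t /=; rewrite !in_itv /= lerDl ltrD2l.
rewrite -(@ge0_integral_pushforward _ _ _ _ R _ mphi leb _ g)//; last first.
  exact: measurable_funS mg.
apply: eq_measure_integral => //= A mA _; symmetry.
apply/esym/lebesgue_measure_unique => //= _ [[b c]] _ <-.
rewrite /pushforward.
have -> : (fun t => a + t) @^-1` `]b, c] = `]b - a, c - a]%classic.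
  by apply/seteqP; split => t /=; rewrite !in_itv /= ltrBlDl lerBrDl.
rewrite !lebesgue_measure_itv /= !lte_fin ltrD2r; case: ifPn => // _.
by rewrite -!EFinB; congr EFin; ring.
Qed.

Lemma integral_lebesgue01 (g : R -> \bar R) : measurable_fun setT g ->
  (forall x, 0 <= g x)%E ->
  (\int[lebesgue01 R]_x g x = \int[leb]_(x in `[0%R, 1%R]) g x)%E.
Proof.
move=> mg g0; pose D : set (measurableTypeR R) := `[0, 1]%classic.
have mD : measurable D by exact: measurable_itv.
rewrite (@ge0_negligible_integral _ _ _ _ setT (~` D)) //; last 2 first.
- exact: measurableC.
- by rewrite /= /lebesgue01 /mrestr /= setICl measure0.
rewrite setTD setCK; apply: eq_measure_integral => A mA AD.
by rewrite /lebesgue01 /= /mrestr (setIidl AD).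
Qed.

(** Integration over the unit interval, block by block, along the fibers
consisting of the translates of one point to all the pieces of the block. *)
Lemma integral_fiber (g : R -> \bar R) : measurable_fun setT g ->
  (forall x, 0 <= g x)%E ->
  (\int[lebesgue01 R]_x g x =
   \sum_(m <oo) \int[leb]_(t in `[0%R, len m[) \sum_(i : I m) g (lo i + t)%R)%E.
Proof.
move=> mg g0; rewrite integral_lebesgue01//.
have -> : (\int[leb]_(x in `[0%R, 1%R]) g x = \int[leb]_(x in `]0%R, 1%R[) g x)%E.
  by rewrite integral_itv_bndoo//; exact: measurable_funS mg.
rewrite -bigcup_block ge0_integral_bigcup//; last 3 first.
- by move=> m; exact: measurable_itv.
- exact: measurable_funS mg.
- apply/trivIsetP => m n _ _ mn; apply/seteqP; split => // s [bm bn].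
  by move: mn; rewrite (block_inj bm bn) eqxx.
apply: eq_eseriesr => m _.
rewrite blockE ge0_integral_bigsetU//; last 4 first.
- by move=> i; exact: measurable_piece.
- exact: enum_uniq.
- apply/trivIsetP => i j _ _ ij; apply/seteqP; split => // s [pi pj].
  by move: ij; rewrite (piece_inj pi pj) eqxx.
- exact: measurable_funS mg.
rewrite big_enum /=.
under eq_bigr do rewrite /piece integral_translate//.
rewrite ge0_integral_sum//.
move=> i; apply: (measurable_funS measurableT) => //.
apply: (measurableT_comp mg).
by apply: measurable_funD => //; exact: measurable_cst.
Qed.

End pieces.

(** * Operators acting on the fibers *)

Section fiberwise.
Context (R : realType) (I : nat -> finType) (I0 : forall m, (0 < #|I m|)%N).
Local Notation C := R[i].
Local Notation T := (measurableTypeR R).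
Local Notation lo := (@lo R I _).
Local Notation len := (len R I).
Local Notation piece := (@piece R I _).
Local Notation mu := (lebesgue01 R).

Definition fiber m (t : R) (f : R -> C) : I m -> C := fun i => f (lo i + t).

Definition cmeasurable (f : T -> C) :=
  measurable_fun setT (fun x => complex.Re (f x)) /\
  measurable_fun setT (fun x => complex.Im (f x)).

(** The value at a point s of the piece i is obtained by applying L to the
restriction of f to the fiber of s and by evaluating the result at i. Outside
the pieces, a null set in the unit interval, the value 0 is a convention. *)
Definition fiberop (L : forall m, (I m -> C) -> I m -> C) (f : T -> C) : T -> C :=
  fun s => if piece_label I s is Some mi
    then L (tag mi) (fiber (s - lo (tagged mi)) f) (tagged mi) else 0.

Lemma fiberopE L f m (i : I m) t : 0 <= t < len m ->
  fiberop L f (lo i + t) = L m (fiber t f) i.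
Proof.
move=> tl; rewrite /fiberop (@piece_labelE _ _ I0 m i); last by apply/pieceP; exists t.
by rewrite /= addrC addKr.
Qed.

Definition delta m (j : I m) : I m -> C := fun i => (i == j)%:R.

(** A linear map on functions of a finite index is a finite sum of multiples of
evaluations, which reduces measurability to that of translates. *)
Lemma linear_delta m (L : (I m -> C) -> I m -> C) y i :
  (forall a x z, L (a *: x + z) = a *: L x + L z) ->
  L y i = \sum_j y j * L (delta j) i.
Proof.
move=> lin.
have L0 : L 0 = 0.
  by have := lin (-1) 0 0; rewrite scaleN1r oppr0 addr0 scaleN1r addNr.
have Ls (s : seq (I m)) : L (\sum_(j <- s) y j *: delta j) = \sum_(j <- s) y j *: L (delta j).
  by elim: s => [|j s IH]; rewrite ?big_nil// !big_cons lin IH.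
rewrite [in LHS](_ : y = \sum_j y j *: delta j); last first.
  apply/funext => k; rewrite fct_sumE (bigD1 k)//= big1 => [|j jk].
    by rewrite addr0 -[RHS]/(y k * (k == k)%:R) eqxx mulr1.
  by rewrite -[LHS]/(y j * (k == j)%:R) eq_sym (negbTE jk) mulr0.
by rewrite Ls fct_sumE.
Qed.

Lemma cmeasurable_fiberop L f :
  (forall m a x z, L m (a *: x + z) = a *: L m x + L m z) ->
  cmeasurable f -> cmeasurable (fiberop L f).
Proof.
move=> lin [mr mi].
have msh (g : R -> R) a b : measurable_fun setT (g : T -> R) ->
    measurable_fun setT ((fun s : R => g (a + (s - b))) : T -> R).
  move=> mg; apply: (measurableT_comp mg).
  apply: measurable_funD; first exact: measurable_cst.
  by apply: measurable_funB => //; exact: measurable_cst.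
have E m (i : I m) s : piece i s -> fiberop L f s =
   \sum_j f (lo j + (s - lo i)) * L m (delta j) i.
  move=> /pieceP[t tl ->]; rewrite fiberopE// (linear_delta _ _ (lin m)).
  by apply: eq_bigr => j _; rewrite [_ + t]addrC addrK.
split.
- apply: (measurable_pieces (G := fun m i s => \sum_j
    (complex.Re (f (lo j + (s - lo i))) * complex.Re (L m (delta j) i) -
     complex.Im (f (lo j + (s - lo i))) * complex.Im (L m (delta j) i)))).
  + move=> m i; apply: measurable_sum => j.
    by apply: measurable_funB; apply: measurable_funM => //;
      [exact: (msh (fun s => complex.Re (f s))) | exact: (msh (fun s => complex.Im (f s)))].
  + move=> m i s /E ->; rewrite Re_sum; apply: eq_bigr => j _.
    by case: (f _) (L _ _ _) => ? ? [].
  + by move=> s ls; rewrite /fiberop ls.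
- apply: (measurable_pieces (G := fun m i s => \sum_j
    (complex.Re (f (lo j + (s - lo i))) * complex.Im (L m (delta j) i) +
     complex.Im (f (lo j + (s - lo i))) * complex.Re (L m (delta j) i)))).
  + move=> m i; apply: measurable_sum => j.
    by apply: measurable_funD; apply: measurable_funM => //;
      [exact: (msh (fun s => complex.Re (f s))) | exact: (msh (fun s => complex.Im (f s)))].
  + move=> m i s /E ->; rewrite Im_sum; apply: eq_bigr => j _.
    by case: (f _) (L _ _ _) => ? ? [].
  + by move=> s ls; rewrite /fiberop ls.
Qed.

Variables (p : R) (p1 : 1 <= p).
Let p0 : 0 < p. Proof. exact: lt_le_trans p1. Qed.
Local Notation V := (Lp mu p1).

Definition lp_pow m (y : I m -> C) : R := \sum_i rnorm (y i) `^ p.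

Lemma lp_pow_ge0 m (y : I m -> C) : 0 <= lp_pow y.
Proof. by apply: sumr_ge0 => i _; exact: powR_ge0. Qed.

Lemma Lpnorm_powR (f : T -> C) : (Lpnorm mu p f `^ p = \int[mu]_s (rnorm (f s) `^ p)%:E)%E.
Proof.
rewrite /Lpnorm poweR_Lnorm; last by rewrite gt_eqF.
apply: eq_integral => s _.
by rewrite gee0_abs ?lee_fin ?rnorm_ge0// poweR_EFin.
Qed.

Lemma measurable_powR_rnorm f : cmeasurable f ->
  measurable_fun setT (fun s => rnorm (f s) `^ p).
Proof.
move=> [mr mi]; apply: (@measurableT_comp _ _ _ _ _ _ (@powR R ^~ p)) => //.
exact: measurable_rnorm.
Qed.

Lemma Lpnorm_fiber f : cmeasurable f ->
  (Lpnorm mu p f `^ p =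
   \sum_(m <oo) \int[lebesgue_measure]_(t in `[0%R, len m[) (lp_pow (fiber t f : I m -> C))%:E)%E.
Proof.
move=> mf; rewrite Lpnorm_powR (integral_fiber I0)//; first last.
- by move=> s; rewrite lee_fin powR_ge0.
- by apply/measurable_EFinP; exact: measurable_powR_rnorm.
by apply: eq_eseriesr => m _; apply: eq_integral => t _; rewrite sumEFin.
Qed.

Lemma measurable_lp_pow m f : cmeasurable f ->
  measurable_fun setT (fun t : T => lp_pow (fiber t f : I m -> C)).
Proof.
move=> mf; apply: measurable_sum => i.
apply: (measurableT_comp (measurable_powR_rnorm mf)).
by apply: measurable_funD => //; exact: measurable_cst.
Qed.

(** An inequality between l_p norms on all fibers integrates to an inequality
between L_p norms. *)
Lemma Lpnorm_fiber_le f g (K : R) : cmeasurable f -> cmeasurable g -> 0 <= K ->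
  (forall m t, 0 <= t < len m -> lp_pow (fiber t f : I m -> C) <= K `^ p * lp_pow (fiber t g : I m -> C)) ->
  (Lpnorm mu p f <= K%:E * Lpnorm mu p g)%E.
Proof.
move=> mf mg K0 fg.
have Ng0 : (0 <= Lpnorm mu p g)%E := Lpnorm_ge0 mu p g.
suff : (Lpnorm mu p f `^ p <= (K%:E * Lpnorm mu p g) `^ p)%E.
  move=> h; have := gt0_ler_poweR (r := p^-1) _ _ _ h.
  rewrite !in_itv /= !leey !andbT -!poweRrM mulfV ?gt_eqF// !poweRe1 ?mule_ge0 ?Lpnorm_ge0//.
  by apply; rewrite ?poweR_ge0// invr_ge0 ltW.
rewrite poweRM ?Lpnorm_ge0// poweR_EFin !Lpnorm_fiber//.
rewrite -nneseriesZl ?lee_fin ?powR_ge0//; last first.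
  by move=> m _; apply: integral_ge0 => t _; rewrite lee_fin lp_pow_ge0.
apply: lee_nneseries => m; first by move=> _ _; apply: integral_ge0 => t _; rewrite lee_fin lp_pow_ge0.
move=> _.
have mfp h : cmeasurable h -> measurable_fun `[0, len m[ (fun t : T => (lp_pow (fiber t h : I m -> C))%:E).
  move=> mh; apply: (measurable_funS measurableT) => //.
  by apply/measurable_EFinP; exact: measurable_lp_pow.
rewrite -ge0_integralZl_EFin ?powR_ge0//; last 2 first.
- by move=> t _; rewrite lee_fin lp_pow_ge0.
- exact: mfp.
apply: ge0_le_integral => //.
- by move=> t _; rewrite lee_fin lp_pow_ge0.
- exact: mfp.
- by apply: measurable_funeM; exact: mfp.
by move=> t; rewrite /= in_itv /= => tl; rewrite -EFinM lee_fin; exact: fg.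
Qed.

Lemma cmeasurable_Lp f : f \in Lp_pred mu p -> cmeasurable f.
Proof. by move=> /isLpP[]. Qed.

Lemma rnorm_Lp_class f (Lf : f \in Lp_pred mu p) :
  (rnorm (Lp_class p1 Lf))%:E = Lpnorm mu p f.
Proof.
rewrite /rnorm -[`|_|]/(Lp_norm _) Lp_class_norm /= fineK//.
exact: Lpnorm_fin.
Qed.

Lemma Lp_class_sub f g (Lf : f \in Lp_pred mu p) (Lg : g \in Lp_pred mu p) :
  Lp_class p1 Lf - Lp_class p1 Lg = Lp_class p1 (Lp_predD p1 Lf (Lp_predN p1 Lg)).
Proof.
by rewrite -[LHS]/(Lp_add _ (Lp_opp _)) Lp_oppE Lp_addE; exact: Lp_class_congr.
Qed.

(** The pieces cover the unit interval up to its end points. *)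
Lemma Lp_fiber_ext f g (Lf : f \in Lp_pred mu p) (Lg : g \in Lp_pred mu p) :
  (forall m (i : I m) t, 0 <= t < len m -> f (lo i + t) = g (lo i + t)) ->
  Lp_class p1 Lf = Lp_class p1 Lg.
Proof.
move=> fg; apply/eqP; rewrite -subr_eq0; apply/eqP/rnorm_eq0.
rewrite Lp_class_sub; set Lfg := Lp_predD _ _ _.
apply/eqP; rewrite eq_le rnorm_ge0 andbT -lee_fin rnorm_Lp_class.
have {1}-> : 0%:E = (0%:E * Lpnorm mu p g)%E by rewrite mul0e.
apply: Lpnorm_fiber_le => //; [exact: cmeasurable_Lp..|].
move=> m t tl; rewrite powR0 ?gt_eqF// mul0r /lp_pow big1// => i _.
by rewrite /fiber !fctE fg// subrr rnorm0 powR0// gt_eqF.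
Qed.

(** Families of linear maps on the fibers, with l_p norms bounded uniformly in
the block: they are the families that induce bounded operators of L_p. *)
Record fibered := Fibered {
  fib :> forall m, (I m -> C) -> I m -> C;
  fib_linear : forall m a x z, fib (a *: x + z) = a *: @fib m x + @fib m z;
  fib_bounded : exists2 K, 0 <= K & forall m y, lp_pow (@fib m y) <= K `^ p * lp_pow y }.

Implicit Types (L : fibered) (x : V).

Lemma fiberop_bound L K f : 0 <= K ->
  (forall m y, lp_pow (L m y) <= K `^ p * lp_pow y) ->
  f \in Lp_pred mu p -> (Lpnorm mu p (fiberop L f) <= K%:E * Lpnorm mu p f)%E.
Proof.
move=> K0 LK Lf; apply: Lpnorm_fiber_le => //.
- by apply: cmeasurable_fiberop (cmeasurable_Lp Lf); exact: fib_linear.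
- exact: cmeasurable_Lp.
move=> m t tl; rewrite (_ : fiber t (fiberop L f) = L m (fiber t f))//.
by apply/funext => i; rewrite /fiber fiberopE.
Qed.

Lemma fiberop_Lp L f : f \in Lp_pred mu p -> fiberop L f \in Lp_pred mu p.
Proof.
move=> Lf; apply/isLpP.
have [m1 m2] : cmeasurable (fiberop L f).
  by apply: cmeasurable_fiberop (cmeasurable_Lp Lf); exact: fib_linear.
split => //; have [K K0 LK] := fib_bounded L.
apply: (le_lt_trans (fiberop_bound K0 LK Lf)).
by rewrite lte_mul_pinfty// ltey_eq Lpnorm_fin.
Qed.

Definition Lpop L x : V := Lp_class p1 (fiberop_Lp L (Lp_funP x)).

(** The operator does not depend on the representative: a difference of
representatives has norm 0, and the norm bound carries this over. *)
Lemma Lpop_class L f (Lf : f \in Lp_pred mu p) :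
  Lpop L (Lp_class p1 Lf) = Lp_class p1 (fiberop_Lp L Lf).
Proof.
set g := Lp_fun (Lp_class p1 Lf); pose Lg : g \in Lp_pred mu p := Lp_funP _.
pose Lfg := Lp_predD p1 Lg (Lp_predN p1 Lf).
have fg0 : Lp_class p1 Lfg = 0.
  by rewrite /Lfg -Lp_class_sub [Lp_class p1 Lg]Lp_funK subrr.
apply/eqP; rewrite -subr_eq0; apply/eqP/rnorm_eq0.
rewrite Lp_class_sub.
transitivity (rnorm (Lp_class p1 (fiberop_Lp L Lfg))).
  congr rnorm.
  apply: Lp_fiber_ext => m i t tl; rewrite !fctE !fiberopE//.
  rewrite [in RHS](_ : fiber t _ = (-1) *: fiber t f + fiber t g); last first.
    by apply/funext => j; rewrite scaleN1r addrC.
  by rewrite fib_linear scaleN1r addrC.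
have [K K0 LK] := fib_bounded L.
apply/eqP; rewrite eq_le rnorm_ge0 andbT -lee_fin rnorm_Lp_class.
apply: (le_trans (fiberop_bound K0 LK Lfg)).
by rewrite -rnorm_Lp_class fg0 rnorm0 mule0.
Qed.

Lemma Lpop_norm L K x : 0 <= K ->
  (forall m y, lp_pow (L m y) <= K `^ p * lp_pow y) -> rnorm (Lpop L x) <= K * rnorm x.
Proof.
move=> K0 LK; rewrite -lee_fin EFinM -{2}(Lp_funK x) !rnorm_Lp_class.
by apply: fiberop_bound => //; exact: Lp_funP.
Qed.

Lemma Lp_class_lin_comb a f g (Lf : f \in Lp_pred mu p) (Lg : g \in Lp_pred mu p) :
  a *: Lp_class p1 Lf + Lp_class p1 Lg = Lp_class p1 (Lp_predD p1 (Lp_predZ p1 a Lf) Lg).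
Proof.
by rewrite -[LHS]/(Lp_add (Lp_scale _ _) _) Lp_scaleE Lp_addE.
Qed.

Lemma Lpop_linear L a x (y : V) : Lpop L (a *: x + y) = a *: Lpop L x + Lpop L y.
Proof.
elim/Lp_ind: x => f Lf; elim/Lp_ind: y => g Lg.
rewrite Lp_class_lin_comb !Lpop_class Lp_class_lin_comb; apply: Lp_fiber_ext => m i t tl.
rewrite !fctE !fiberopE// (_ : fiber t _ = a *: fiber t f + fiber t g)//.
by rewrite fib_linear.
Qed.

Lemma Lpop_lin_comb (N : fibered) L L' a : (forall m y, N m y = a *: L m y + L' m y) ->
  forall x, Lpop N x = a *: Lpop L x + Lpop L' x.
Proof.
move=> NE; elim/Lp_ind => f Lf; rewrite !Lpop_class Lp_class_lin_comb.
by apply: Lp_fiber_ext => m i t tl; rewrite !fctE !fiberopE// NE.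
Qed.

Lemma Lpop_ext (N : fibered) L : (forall m y, N m y = L m y) ->
  forall x, Lpop N x = Lpop L x.
Proof.
move=> NE; elim/Lp_ind => f Lf; rewrite !Lpop_class.
by apply: Lp_fiber_ext => m i t tl; rewrite !fiberopE// NE.
Qed.

Lemma Lpop_comp (N : fibered) L L' : (forall m y, N m y = L m (L' m y)) ->
  forall x, Lpop N x = Lpop L (Lpop L' x).
Proof.
move=> NE; elim/Lp_ind => f Lf; rewrite !Lpop_class.
apply: Lp_fiber_ext => m i t tl; rewrite !fiberopE// NE; congr (L m _ i).
by apply/funext => j; rewrite /fiber fiberopE.
Qed.

Lemma Lpop_id (N : fibered) : (forall m y, N m y = y) -> forall x, Lpop N x = x.
Proof.
move=> NE; elim/Lp_ind => f Lf; rewrite !Lpop_class.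
by apply: Lp_fiber_ext => m i t tl; rewrite !fiberopE// NE.
Qed.

(** Truncations to the first k blocks converge strongly to the identity: the
p-th power of the norm of the remainder is the tail of a convergent series. *)
Lemma Lpop_trunc (N : nat -> fibered) x :
  (forall k m y, N k m y = if (m < k)%N then y else 0) ->
  forall e, 0 < e -> exists k, rnorm (x - Lpop (N k) x) < e.
Proof.
move=> NE e e0; elim/Lp_ind: x => f Lf.
pose a m := (\int[lebesgue_measure]_(t in `[0%R, len m[) (lp_pow (fiber t f : I m -> C))%:E)%E.
have a0 m : (0 <= a m)%E by apply: integral_ge0 => t _; rewrite lee_fin lp_pow_ge0.
have mf := cmeasurable_Lp Lf.
have sa : (\sum_(m <oo) a m < +oo)%E.
  by rewrite -Lpnorm_fiber// poweR_lty// ltey_eq Lpnorm_fin.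
have ep0 : (0 < (e `^ p)%:E)%E by rewrite lte_fin powR_gt0.
have : \forall k \near \oo, (\sum_(k <= m <oo) a m < (e `^ p)%:E)%E.
  have := nneseries_tail_cvg (P := xpredT) sa (fun k _ => a0 k).
  by move=> /(_ [set y | (y < (e `^ p)%:E)%E] (lt_nbhsl ep0)).
move=> [k _ /(_ k (leqnn k)) /= ak]; exists k.
rewrite Lpop_class Lp_class_sub; set Lg := Lp_predD _ _ _; set g := (f + _) in Lg *.
rewrite -lte_fin rnorm_Lp_class.
have mg := cmeasurable_Lp Lg.
suff : (Lpnorm mu p g `^ p < e%:E `^ p)%E.
  move=> h; rewrite ltNge; apply/negP => eg; move: h; rewrite ltNge => /negP; apply.
  by apply: gt0_ler_poweR => //; rewrite ?in_itv /= ?leey ?andbT ?lee_fin ?Lpnorm_ge0 ?ltW.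
rewrite (poweR_EFin e p); apply: le_lt_trans ak; rewrite (Lpnorm_fiber mg).
rewrite [leLHS](nneseries_split 0 k); last first.
  by move=> m _; apply: integral_ge0 => t _; rewrite lee_fin lp_pow_ge0.
have gE m (t : R) : 0 <= t < len m ->
    lp_pow (fiber t g : I m -> C) = if (m < k)%N then 0 else lp_pow (fiber t f : I m -> C).
  move=> tl.
  rewrite (_ : fiber t g = if (m < k)%N then 0 else fiber t f :> (I m -> C)); last first.
    apply/funext => i; rewrite /fiber /g !fctE fiberopE// NE.
    by case: ifP => _; rewrite ?subrr// subr0.
  by case: ifP => // _; rewrite /lp_pow big1// => i _; rewrite rnorm0 powR0// gt_eqF.
rewrite big1_seq ?add0e; last first.
  move=> m /=; rewrite mem_index_iota add0n => /andP[_ mk].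
  apply: integral0_eq => t; rewrite /= in_itv /= => tl; by rewrite gE// mk.
rewrite add0n; apply: lee_nneseries.
  by move=> m _ _; apply: integral_ge0 => t _; rewrite lee_fin lp_pow_ge0.
move=> m _; apply: ge0_le_integral => //.
- by move=> t _; rewrite lee_fin lp_pow_ge0.
- apply: (measurable_funS measurableT) => //.
  by apply/measurable_EFinP; exact: measurable_lp_pow.
- apply: (measurable_funS measurableT) => //.
  by apply/measurable_EFinP; exact: measurable_lp_pow.
move=> t; rewrite /= in_itv /= => tl; rewrite lee_fin gE//.
by case: ifP => // _; exact: lp_pow_ge0.
Qed.

End fiberwise.

(** * Geometry of sectors *)

Section sectors.
Context (R : realType).
Local Notation C := R[i].

(** With n the modulus of l, the square of the right-hand side is at least
n^2 + a^2 - 2 a c n, which exceeds the square of the left-hand side by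
(1 + c) / 2 * (n - a)^2. *)
Lemma sector_dist (c a : R) (l : C) : c <= 1 -> -1 <= c -> 0 <= a ->
  complex.Re l <= c * rnorm l ->
  Num.sqrt ((1 - c) / 2) * (rnorm l + a) <= rnorm (l - a%:C).
Proof.
move=> c1 cN1 a0 lc.
have n0 := rnorm_ge0 l; have nl := rnorm_sqr l.
rewrite -(@ler_pXn2r _ 2)// ?nnegrE ?rnorm_ge0 ?mulr_ge0 ?sqrtr_ge0 ?addr_ge0//.
rewrite exprMn sqr_sqrtr ?divr_ge0 ?subr_ge0// rnorm_sqr.
case: l lc n0 nl => x y /=; set n := rnorm _ => lc n0 nl.
rewrite subr0.
rewrite (_ : (x - a) ^+ 2 + y ^+ 2 = n ^+ 2 - 2 * a * x + a ^+ 2); last by rewrite nl; ring.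
have h : 2 * a * x <= 2 * a * (c * n) by rewrite ler_wpM2l ?mulr_ge0.
have h2 : 0 <= (1 + c) / 2 * (n - a) ^+ 2 by rewrite mulr_ge0 ?sqr_ge0// divr_ge0//; lra.
rewrite -subr_ge0; apply: (le_trans h2).
rewrite -subr_ge0; rewrite -subr_ge0 in h; apply: (le_trans h).
by rewrite le_eqVlt; apply/orP; left; apply/eqP; field.
Qed.

Lemma arg_pos (r : R) : 0 < r -> arg (r%:C) = 0.
Proof.
by move=> r0; rewrite /arg rnormC /= lexx (gtr0_norm r0) divff ?gt_eqF// acos1.
Qed.

Lemma zero_in_sector_closure (w : R) : 0 < w -> closure (sector w) (0 : C^o).
Proof.
move=> w0 B /nbhs_ballP[e /= e0 eB].
have [er e0r] : exists2 r : R, 0 < r & (r%:C < e).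
  have eE : e = (complex.Re e)%:C.
    by move: e0; case: (e) => a b; rewrite ltcE /= => /andP[/eqP -> _].
  move: e0; rewrite eE -(rmorph0 (@real_complex R)) ltcR => e0.
  by exists (complex.Re e / 2); [rewrite divr_gt0 | rewrite ltcR ltr_pdivrMr// ltr_pMr// ltr1n].
exists (er%:C); split.
  rewrite /sector /= arg_pos// normr0; split => //.
  by rewrite -(rmorph0 (@real_complex R)) (inj_eq (@complexI R)) gt_eqF.
apply: eB; rewrite -ball_normE /ball_ /= sub0r normrN.
by rewrite normc_def /= expr0n addr0 sqrtr_sqr gtr0_norm.
Qed.

(** Outside the closed sector the modulus of the argument is at least w, and the
cosine decreases on [0, pi]; the minimum with pi allows every opening angle. *)
Lemma notin_sector (w : R) (l : C) : 0 < w -> ~ closure (sector w) (l : C^o) ->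
  l != 0 /\ complex.Re l <= cos (Num.min w pi) * rnorm l.
Proof.
move=> w0 lw.
have l0 : l != 0.
  by apply/eqP => l0; apply: lw; rewrite l0; exact: zero_in_sector_closure.
split => //.
have [/andP[a1 a2] lE] := argP l0.
have wa : w <= `|arg l|.
  rewrite leNgt; apply/negP => aw; apply: lw; apply: subset_closure.
  by rewrite /sector /=.
rewrite [in leLHS]lE mulcR /= mulrC ler_wpM2r ?rnorm_ge0//.
rewrite -(cos_norm (arg l)).
have api : `|arg l| <= pi by rewrite ler_norml a2 ltW.
rewrite leNgt ltr_cos ?in_itv /= ?normr_ge0 ?api ?le_min ?(ltW w0) ?pi_ge0 ?ge_min ?lexx ?orbT//.
by rewrite -leNgt ge_min wa.
Qed.

(** The only property of the complement of a sector from which resolvents are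
estimated: the distance from l to a positive number a is comparable to the sum
of their moduli. *)
Lemma sector_dist_pos (v : R) : 0 < v -> exists2 c : R, 0 < c &
  forall l : C, ~ closure (sector v) (l : C^o) ->
    l != 0 /\ (forall a, 0 <= a -> c * (rnorm l + a) <= rnorm (l - a%:C)).
Proof.
move=> v0; set c := cos (Num.min v pi).
have c1 : c < 1.
  rewrite /c -[ltRHS]cos0 ltr_cos ?in_itv /= ?lexx ?pi_ge0 ?ge_min ?le_min ?lexx ?(ltW v0) ?pi_ge0 ?orbT//.
  by rewrite lt_min v0 pi_gt0.
exists (Num.sqrt ((1 - c) / 2)); first by rewrite sqrtr_gt0 divr_gt0 ?subr_gt0.
move=> l /(notin_sector v0)[l0 lRe]; split => // a a0.
by apply: sector_dist => //; [exact: ltW|exact: cos_geN1].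
Qed.

Lemma sector_Re (w : R) (z : C) : w <= pi -> sector w (z : C^o) ->
  cos w * rnorm z <= complex.Re z.
Proof.
move=> wpi [z0 zw]; have [/andP[a1 a2] zE] := argP z0.
rewrite [in leRHS]zE mulcR /= mulrC ler_wpM2l ?rnorm_ge0//.
rewrite -(cos_norm (arg z)) leNgt ltr_cos ?in_itv /= ?normr_ge0 ?wpi ?andbT/=.
- by rewrite -leNgt ltW.
- by rewrite (le_trans (normr_ge0 _) (ltW zw)).
- by rewrite (le_trans (ltW zw)).
Qed.

Lemma closure_sector_Re (w : R) (l : C) : w <= pi -> closure (sector w) (l : C^o) ->
  cos w * rnorm l <= complex.Re l.
Proof.
move=> wpi cl; rewrite leNgt; apply/negP => lt.
set d := cos w * rnorm l - complex.Re l.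
have d0 : 0 < d by rewrite subr_gt0.
have [|z [zs]] := cl (ball (l : C^o) (d / 4)%:C).
  by apply: nbhsx_ballx; rewrite -(rmorph0 (@real_complex R)) ltcR divr_gt0.
rewrite -ball_normE /ball_ /= [`|_|](rnormE (l - z : C)) ltcR => lz.
have zRe := sector_Re wpi zs.
have Relz : complex.Re z - complex.Re l <= rnorm (l - z).
  apply: le_trans (ler_Re_rnorm _); rewrite -normrN; apply: le_trans (ler_norm _).
  by rewrite -[leLHS]opprB lerN2; case: (l) (z) => ? ? [].
have lE : rnorm l <= rnorm z + rnorm (l - z) by rewrite -{1}(subrKC z l) ler_rnormD.
have zE : rnorm z <= rnorm l + rnorm (l - z).
  rewrite -{1}(subKr l z) (le_trans (ler_rnormD _ _))// lerD2l.
  by rewrite /rnorm normrN.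
have h : cos w * (rnorm l - rnorm z) <= rnorm (l - z).
  have : `|cos w * (rnorm l - rnorm z)| <= 1 * rnorm (l - z).
    by rewrite normrM ler_pM ?normr_ge0 ?cos_max// ler_norml; apply/andP; split; lra.
  by rewrite mul1r; apply: le_trans; exact: ler_norm.
by move: d0 lz h; rewrite /d mulrBr; lra.
Qed.

(** The closed condition of [closure_sector_Re] fails for negative numbers, since
the cosine of w exceeds -1. *)
Lemma neg_notin_sector (w d : R) : 0 < w < pi -> 0 < d ->
  ~ closure (sector w) (- d%:C : C^o).
Proof.
move=> /andP[w0 wpi] d0 /(closure_sector_Re (ltW wpi)).
have -> : rnorm (- d%:C : C) = d by rewrite /rnorm normrN -/(rnorm _) rnormC gtr0_norm.
rewrite /= -mulN1r ler_pM2r// leNgt -cospi ltr_cos ?in_itv /= ?pi_ge0 ?lexx ?(ltW w0) ?(ltW wpi)//.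
by rewrite wpi.
Qed.

Lemma bounded_continuous (X Y : normedModType C) (T : X -> Y) (K : R) :
  (forall x y, T (x - y) = T x - T y) -> (forall x, rnorm (T x) <= K * rnorm x) ->
  continuous T.
Proof.
move=> Tlin TK x; apply/cvgrPdist_lt => e e0.
pose K' := Num.max K 1.
have K'0 : 0 < K' by rewrite lt_max ltr01 orbT.
have K'C : (0 : C) < K'%:C by rewrite -(rmorph0 (@real_complex R)) ltcR.
near=> y.
rewrite -Tlin rnormE.
have : (rnorm (T (x - y)))%:C <= K'%:C * `|x - y|.
  rewrite [`|_|]rnormE -rmorphM lecR (le_trans (TK _))// ler_wpM2r ?rnorm_ge0//.
  by rewrite /K' le_max lexx.
move=> /le_lt_trans; apply; rewrite mulrC -ltr_pdivlMr//.
near: y; apply/nbhs_ballP; exists (e / K'%:C) => /=; first by rewrite divr_gt0.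
by move=> y; rewrite -ball_normE.
Unshelve. all: by end_near. Qed.

End sectors.

(** * The sectorial operator *)

Section variation_bounds.
Context (R : realType).
Local Notation C := R[i].
Implicit Types (phi psi : nat -> C).

(** The total mass of the coefficients in [calc_abel]; it mixes the increments
between consecutive even indices and those from an odd index to the next. *)
Definition variation phi m : R :=
  \sum_(j < m) rnorm (phi j.*2 - phi j.*2.+2) + rnorm (phi m.*2) +
    \sum_(j < m) rnorm (phi j.*2.+1 - phi j.*2.+2).

Definition bvar (B : R) phi :=
  (forall j, rnorm (phi j) <= B) /\ (forall m, variation phi m <= B).

Lemma bvar_affine (B : R) phi a b : bvar B phi ->
  bvar (rnorm a * B + rnorm b) (fun j => a * phi j + b).
Proof.
move=> [phiB varB].
have aff j : rnorm (a * phi j + b) <= rnorm a * rnorm (phi j) + rnorm b.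
  by rewrite -rnormM ler_rnormD.
split => [j|m].
  by rewrite (le_trans (aff j))// lerD2r ler_wpM2l ?rnorm_ge0.
have dif i j : rnorm (a * phi i + b - (a * phi j + b)) = rnorm a * rnorm (phi i - phi j).
  by rewrite -rnormM; congr rnorm; ring.
have := ler_wpM2l (rnorm_ge0 a) (varB m); rewrite /variation !mulrDr !mulr_sumr => h.
under eq_bigr do rewrite dif.
under [X in _ + _ + X <= _]eq_bigr do rewrite dif.
by have := aff m.*2; lra.
Qed.

(** Increments dominated by those of a bounded monotone sequence telescope. *)
Lemma bvar_monotone phi (g : nat -> R) (D S : R) : 0 <= D ->
  (forall j, 0 <= g j <= 1) -> (forall i j, (i <= j)%N -> g i <= g j) ->
  (forall i j, (i <= j)%N -> rnorm (phi i - phi j) <= D * (g j - g i)) ->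
  (forall j, rnorm (phi j) <= S) -> bvar (2 * D + S) phi.
Proof.
move=> D0 g01 gmono phig phiS; split => [j|m].
  by rewrite (le_trans (phiS j))// lerDr mulr_ge0.
have tel : \sum_(j < m) D * (g j.*2.+2 - g j.*2) <= D.
  rewrite -mulr_sumr -(big_mkord xpredT (fun j => g j.+1.*2 - g j.*2)).
  rewrite (telescope_sumr (fun j => g j.*2))// ler_piMr//.
  by have := g01 m.*2; have := g01 0%N; lra.
have h1 : \sum_(j < m) rnorm (phi j.*2 - phi j.*2.+2) <= D.
  by apply: le_trans tel; apply: ler_sum => j _; apply: phig; lia.
have h2 : \sum_(j < m) rnorm (phi j.*2.+1 - phi j.*2.+2) <= D.
  apply: le_trans tel; apply: ler_sum => j _.
  apply: (le_trans (phig _ _ (leqnSn _))).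
  by rewrite ler_wpM2l// lerB// gmono.
by have := phiS m.*2; rewrite /variation; lra.
Qed.

End variation_bounds.

Section multiplier.
Context (R : realType) (p : R) (p1 : 1 <= p).
Local Notation C := R[i].
Local Notation mu := (lebesgue01 R).
Local Notation V := (Lp mu p1).

Definition block_type (m : nat) : finType := block_index m.

Lemma card_block_type m : (0 < #|block_type m|)%N.
Proof. by apply/card_gt0P; exists (None, [ffun=> false]). Qed.

Let p0 : 0 < p. Proof. exact: lt_le_trans p1. Qed.

Lemma bvar_calc_le B (phi : nat -> C) m (y : block_type m -> C) : bvar B phi ->
  lp_pow p (calc phi y : block_type m -> C) <= (2 * B) `^ p * lp_pow p y.
Proof.
move=> [phiB varB]; have B0 : 0 <= B by exact: le_trans (rnorm_ge0 _) (phiB 0).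
apply: (le_trans (calc_lp_bound (S := B) (V := B) y p1 (fun j _ => phiB j) (varB m))).
rewrite ler_wpM2r ?lp_pow_ge0// powRM// -mulr2n -[B `^ p *+ 2]mulr_natl.
by rewrite ler_wpM2r ?powR_ge0// -[X in X <= _]powRr1// ler_powR// ler1n.
Qed.

Lemma calc_block_bounded (phi : nat -> C) m : exists2 K, 0 <= K &
  forall y : block_type m -> C, lp_pow p (calc phi y : block_type m -> C) <= K `^ p * lp_pow p y.
Proof.
pose S := \sum_(j < m.*2.+1) rnorm (phi j); pose W := variation phi m.
have S0 : 0 <= S by apply: sumr_ge0 => j _; exact: rnorm_ge0.
exists ((W `^ p + S `^ p) `^ p^-1) => [|y]; first exact: powR_ge0.
rewrite -powRrM mulVf ?gt_eqF// powRr1 ?addr_ge0 ?powR_ge0//.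
apply: calc_lp_bound => // j jm.
have jm' : (j < m.*2.+1)%N by rewrite ltnS.
rewrite /S (bigD1 (Ordinal jm'))//= lerDl.
by apply: sumr_ge0 => i _; exact: rnorm_ge0.
Qed.

Definition calc_fibered (phi : nat -> C) (h : exists B, bvar B phi) : fibered block_type p.
Proof.
refine (@Fibered R block_type p (fun m y => calc phi y) _ _).
  by move=> m a x z; exact: calc_linear.
case: h => B [phiB varB].
have B0 : 0 <= B by exact: le_trans (rnorm_ge0 _) (phiB 0).
by exists (2 * B) => [|m y]; [rewrite mulr_ge0|apply: bvar_calc_le].
Defined.

(** psi(A) for the sequence phi of the values of psi at the eigenvalues. The
default value 0 makes it a total function of the sequence. *)
Definition multiplier (phi : nat -> C) (x : V) : V :=
  if pselect (exists B, bvar B phi) is left h then Lpop card_block_type (calc_fibered h) x else 0.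

Lemma multiplierE (phi : nat -> C) (h : exists B, bvar B phi) x :
  multiplier phi x = Lpop card_block_type (calc_fibered h) x.
Proof. by rewrite /multiplier; case: pselect => // h'; apply: Lpop_ext. Qed.

Lemma multiplier_linear phi a x y :
  multiplier phi (a *: x + y) = a *: multiplier phi x + multiplier phi y.
Proof.
rewrite /multiplier; case: pselect => [h|_]; first exact: Lpop_linear.
by rewrite scaler0 addr0.
Qed.

Lemma multiplier_lin_comb (phi psi : nat -> C) a x :
  (exists B, bvar B phi) -> (exists B, bvar B psi) ->
  (exists B, bvar B (fun j => a * phi j + psi j)) ->
  multiplier (fun j => a * phi j + psi j) x = a *: multiplier phi x + multiplier psi x.
Proof.
move=> h1 h2 h3; rewrite !multiplierE; apply: Lpop_lin_comb => m y; exact: calc_lin_comb.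
Qed.

Lemma multiplier_mul (phi psi : nat -> C) x :
  (exists B, bvar B phi) -> (exists B, bvar B psi) ->
  (exists B, bvar B (fun j => phi j * psi j)) ->
  multiplier phi (multiplier psi x) = multiplier (fun j => phi j * psi j) x.
Proof.
move=> h1 h2 h3; rewrite !multiplierE; apply/esym; apply: Lpop_comp => m y.
by rewrite /= calc_mul.
Qed.

Lemma bvar_cst (b : C) : exists B, bvar B (fun=> b).
Proof.
exists (2 * 0 + rnorm b); apply: (bvar_monotone (g := fun=> 0)) => // [j|i j ij].
- by rewrite lexx ler01.
- by rewrite subrr rnorm0 mul0r.
Qed.

Lemma multiplier_cst b x : multiplier (fun=> b) x = b *: x.
Proof.
(* Write the constant as (b - 1) * 1 + 1 to use linearity in the symbol. *)
have id1 : multiplier (fun=> 1) x = x.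
  by rewrite (multiplierE (bvar_cst 1)); apply: Lpop_id => m y; exact: calc1.
have -> : (fun=> b) = (fun j : nat => (b - 1) * (fun=> 1) j + (fun=> 1 : C) j).
  by apply/funext => j; rewrite mulr1 subrK.
rewrite multiplier_lin_comb; [|exact: bvar_cst..].
by rewrite id1 -[X in _ + X]scale1r -scalerDl subrK.
Qed.

Lemma multiplier_norm B phi x : bvar B phi -> rnorm (multiplier phi x) <= 2 * B * rnorm x.
Proof.
move=> h; have [phiB _] := h.
have B0 : 0 <= B by exact: le_trans (rnorm_ge0 _) (phiB 0).
rewrite (multiplierE (ex_intro _ B h)); apply: Lpop_norm => [|m y]; first by rewrite mulr_ge0.
exact: bvar_calc_le.
Qed.

Lemma multiplier_continuous phi : continuous (multiplier phi).
Proof.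
have lin x y : multiplier phi (x - y) = multiplier phi x - multiplier phi y.
  by rewrite addrC -scaleN1r multiplier_linear scaleN1r addrC.
case: (pselect (exists B, bvar B phi)) => [[B h]|nh].
  by apply: (bounded_continuous lin (K := 2 * B)) => x; exact: multiplier_norm.
by apply: (bounded_continuous lin (K := 0)) => x; rewrite /multiplier; case: pselect => // _; rewrite rnorm0 mul0r.
Qed.

Definition dyadic j : R := 2^-1 ^+ j.

Lemma dyadic_gt0 j : 0 < dyadic j. Proof. by rewrite exprn_gt0// invr_gt0. Qed.

Lemma dyadic_le i j : (i <= j)%N -> dyadic j <= dyadic i.
Proof. by move=> ij; rewrite ler_wiXn2l// ?invr_ge0// invf_le1// ler1n. Qed.

Lemma dyadic_le1 j : dyadic j <= 1.
Proof. by have := dyadic_le (leq0n j); rewrite {2}/dyadic expr0. Qed.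

Lemma bvar_dyadic : exists B, bvar B (fun j => (dyadic j)%:C).
Proof.
(* The sequence itself is decreasing; its complement to 1 increases. *)
exists (2 * 1 + 1); apply: (bvar_monotone (g := fun j => 1 - dyadic j)) => // [j|i j ij|i j ij|j].
- by rewrite subr_ge0 dyadic_le1/= gerBl ltW// dyadic_gt0.
- by rewrite lerB// dyadic_le.
- rewrite -rmorphB rnormC mul1r ger0_norm ?subr_ge0 ?dyadic_le//; lra.
- by rewrite rnormC gtr0_norm ?dyadic_gt0// dyadic_le1.
Qed.

Definition dyadic_op : operator V := @Operator R V setT (multiplier (fun j => (dyadic j)%:C)) Logic.I
  (fun _ _ _ _ _ => Logic.I) (fun a x y _ _ => multiplier_linear _ a x y).

(** The values of z |-> (l - z)^-1 at the eigenvalues. *)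
Definition resolvent_symbol (l : C) (j : nat) : C := (l - (dyadic j)%:C)^-1.

(** The point l is only assumed to be away from the positive half-line in the
sense of [sector_dist_pos]; the bounds depend on l only through c, apart from
the homogeneity factor 1 / |l|. *)
Section resolvent.
Variables (c : R) (l : C).
Hypothesis c0 : 0 < c.
Hypothesis l0 : l != 0.
Hypothesis lc : forall a, 0 <= a -> c * (rnorm l + a) <= rnorm (l - a%:C).

Let n0 : 0 < rnorm l. Proof. exact: rnorm_gt0. Qed.

Lemma sub_dyadic_neq0 j : l - (dyadic j)%:C != 0.
Proof.
have : 0 < rnorm (l - (dyadic j)%:C).
  by apply: lt_le_trans (lc (ltW (dyadic_gt0 j))); rewrite mulr_gt0// addr_gt0// dyadic_gt0.
by apply: contraTneq => ->; rewrite rnorm0 ltxx.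
Qed.

Lemma rnorm_resolvent_symbol j : rnorm (resolvent_symbol l j) <= (c * (rnorm l + dyadic j))^-1.
Proof.
have dj := dyadic_gt0 j.
rewrite /resolvent_symbol rnormV lef_pV2 ?posrE ?mulr_gt0 ?addr_gt0//; first exact/lc/ltW.
by apply: lt_le_trans (lc (ltW dj)); rewrite mulr_gt0// addr_gt0.
Qed.

(** The increments of z |-> (l - z)^-1 are dominated by those of
z |-> |l| / (|l| + z), which is monotone with values in [0, 1]. *)
Lemma bvar_resolvent : bvar ((2 / c ^+ 2 + c^-1) / rnorm l) (resolvent_symbol l).
Proof.
have -> : (2 / c ^+ 2 + c^-1) / rnorm l = 2 * (c ^+ 2 * rnorm l)^-1 + (c * rnorm l)^-1.
  by field; rewrite !gt_eqF.
apply: (bvar_monotone (g := fun j => rnorm l / (rnorm l + dyadic j))) => [|j|i j ij|i j ij|j].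
- by rewrite invr_ge0 mulr_ge0 ?exprn_ge0 ?(ltW c0) ?(ltW n0).
- have dj := dyadic_gt0 j.
  have sj : 0 < rnorm l + dyadic j by rewrite addr_gt0.
  by rewrite divr_ge0 ?(ltW n0) ?(ltW sj)//= ler_pdivrMr// mul1r lerDl (ltW dj).
- have dj := dyadic_gt0 j; have di := dyadic_gt0 i.
  by rewrite ler_wpM2l ?(ltW n0)// lef_pV2 ?posrE ?addr_gt0// lerD2l dyadic_le.
- have dj := dyadic_gt0 j; have di := dyadic_gt0 i; have dij := dyadic_le ij.
  have -> : resolvent_symbol l i - resolvent_symbol l j = (dyadic i - dyadic j)%:C * (resolvent_symbol l i * resolvent_symbol l j).
    rewrite /resolvent_symbol rmorphB; have := sub_dyadic_neq0 i; have := sub_dyadic_neq0 j.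
    by move=> h1 h2; field; rewrite h1.
  rewrite !rnormM rnormC ger0_norm ?subr_ge0//.
  have -> : (c ^+ 2 * rnorm l)^-1 *
     (rnorm l / (rnorm l + dyadic j) - rnorm l / (rnorm l + dyadic i)) =
     (dyadic i - dyadic j) * ((c * (rnorm l + dyadic i))^-1 * (c * (rnorm l + dyadic j))^-1).
    by field; rewrite !gt_eqF ?addr_gt0.
  by rewrite ler_wpM2l ?subr_ge0// ler_pM ?rnorm_ge0 ?rnorm_resolvent_symbol.
- have dj := dyadic_gt0 j.
  apply: (le_trans (rnorm_resolvent_symbol j)).
  by rewrite lef_pV2 ?posrE ?mulr_gt0 ?addr_gt0// ler_pM2l// lerDl (ltW dj).
Qed.

Lemma bvar_resolvent_ex : exists B, bvar B (resolvent_symbol l).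
Proof. by eexists; exact: bvar_resolvent. Qed.

(** z / (l - z) = l / (l - z) - 1. *)
Lemma resolvent_symbol_dyadic :
  (fun j => resolvent_symbol l j * (dyadic j)%:C) = (fun j => l * resolvent_symbol l j + (fun=> -1) j).
Proof.
apply/funext => j /=; rewrite -(mulVf (sub_dyadic_neq0 j)) -/(resolvent_symbol l j) mulrC.
by rewrite mulrBr; ring.
Qed.

Lemma multiplier_resolvent_dyadic x :
  multiplier (fun j => resolvent_symbol l j * (dyadic j)%:C) x =
  l *: multiplier (resolvent_symbol l) x - x.
Proof.
rewrite resolvent_symbol_dyadic.
rewrite multiplier_lin_comb; first by rewrite multiplier_cst scaleN1r.
- exact: bvar_resolvent_ex.
- exact: bvar_cst.
- by eexists; apply: bvar_affine; exact: bvar_resolvent.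
Qed.

Lemma bvar_resolvent_dyadic :
  exists B, bvar B (fun j => resolvent_symbol l j * (dyadic j)%:C).
Proof.
rewrite resolvent_symbol_dyadic.
by eexists; apply: bvar_affine; exact: bvar_resolvent.
Qed.

Lemma resolvent_left x : multiplier (resolvent_symbol l) (l *: x - dyadic_op x) = x.
Proof.
rewrite -[_ - _]/(l *: x + - dyadic_op x) multiplier_linear -scaleN1r -[_ *: dyadic_op x]addr0.
have lin0 : multiplier (resolvent_symbol l) 0 = 0.
  by have := multiplier_linear (resolvent_symbol l) (-1) 0 0; rewrite scaler0 addr0 scaleN1r addNr.
rewrite multiplier_linear lin0 addr0 scaleN1r /= multiplier_mul; last 3 first.
- exact: bvar_resolvent_ex.
- exact: bvar_dyadic.
- exact: bvar_resolvent_dyadic.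
by rewrite multiplier_resolvent_dyadic subKr.
Qed.

Lemma resolvent_right x :
  l *: multiplier (resolvent_symbol l) x - dyadic_op (multiplier (resolvent_symbol l) x) = x.
Proof.
have E : (fun j => (dyadic j)%:C * resolvent_symbol l j) = (fun j => resolvent_symbol l j * (dyadic j)%:C).
  by apply/funext => j; rewrite mulrC.
rewrite /= multiplier_mul ?E.
- by rewrite multiplier_resolvent_dyadic subKr.
- exact: bvar_dyadic.
- exact: bvar_resolvent_ex.
- exact: bvar_resolvent_dyadic.
Qed.

Lemma resolvent_bij : set_bij (dom dyadic_op) setT (fun x => l *: x - dyadic_op x).
Proof.
split => //= [x y _ _ /(congr1 (multiplier (resolvent_symbol l)))|x _].
  by rewrite !resolvent_left.
by exists (multiplier (resolvent_symbol l) x); rewrite ?resolvent_right.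
Qed.

Lemma resolventE : resolvent dyadic_op l = multiplier (resolvent_symbol l).
Proof.
apply/funext => x; rewrite -[in LHS](resolvent_right x) /resolvent pinvKV ?inE//.
by case: resolvent_bij.
Qed.

Lemma in_resolvent_set : resolvent_set dyadic_op l.
Proof.
split; first exact: resolvent_bij.
by rewrite resolventE; exact: multiplier_continuous.
Qed.

Lemma scaled_resolvent_norm x :
  rnorm (l *: resolvent dyadic_op l x) <= 2 * (2 / c ^+ 2 + c^-1) * rnorm x.
Proof.
have rZ (z : V) : rnorm (l *: z) = rnorm l * rnorm z.
  by apply: complexI; rewrite rmorphM /= -!rnormE normrZ.
rewrite rZ resolventE (le_trans (ler_wpM2l (ltW n0) (multiplier_norm x bvar_resolvent)))//.
by rewrite le_eqVlt; apply/orP; left; apply/eqP; field; rewrite !gt_eqF.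
Qed.

End resolvent.

Lemma dyadic_op_closed : closed_operator dyadic_op.
Proof.
have cA : continuous dyadic_op by exact: multiplier_continuous.
rewrite /closed_operator (_ : mkset _ =
   (fun xy : V * V => xy.2 - dyadic_op xy.1) @^-1` [set 0]); last first.
  apply/seteqP; split => -[x y] /=; first by move=> [_ ->]; rewrite subrr.
  by move=> /eqP; rewrite subr_eq0 => /eqP.
apply: preimage_closed; last first.
  exact: (@accessible_closed_set1 _ (hausdorff_accessible (@norm_hausdorff _ _))).
move=> xy _; apply: (@continuousB _ _ _ (fun xy : V * V => xy.2) (fun xy : V * V => dyadic_op xy.1)).
  exact: cvg_snd.
apply: (@continuous_comp _ _ _ (fun xy : V * V => xy.1) dyadic_op); first exact: cvg_fst.
exact: cA.
Qed.

Lemma dyadic_op_dense : densely_defined dyadic_op.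
Proof. by move=> O [x Ox] _; exists x. Qed.

(** Block maps without a uniform bound become bounded once all but finitely many
of them are replaced by 0. *)
Definition truncated (L : forall m, (block_type m -> C) -> block_type m -> C)
  (lin : forall m a x z, L m (a *: x + z) = a *: L m x + L m z)
  (bnd : forall m, exists2 K, 0 <= K & forall y, lp_pow p (L m y) <= K `^ p * lp_pow p y)
  (k : nat) : fibered block_type p.
Proof.
refine (@Fibered R block_type p (fun m y => if (m < k)%N then L m y else 0) _ _).
  by move=> m a x z; case: ifP => _; rewrite ?lin// scaler0 addr0.
suff [K K0 HK] : exists2 K, 0 <= K & forall m, (m < k)%N -> forall y, lp_pow p (L m y) <= K `^ p * lp_pow p y.
  exists K => // m y; case: ifP => [mk|_]; first exact: HK.
  by rewrite /lp_pow big1 ?mulr_ge0 ?powR_ge0 ?lp_pow_ge0// => i _; rewrite rnorm0 powR0// gt_eqF.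
elim: k => [|k [K K0 IH]]; first by exists 0.
have [K1 K10 HK1] := bnd k.
exists (Num.max K K1) => [|m]; first by rewrite le_max K0.
rewrite ltnS leq_eqVlt => /orP[/eqP->|mk] y.
  apply: (le_trans (HK1 y)); rewrite ler_wpM2r ?lp_pow_ge0//.
  by rewrite ge0_ler_powR ?(ltW p0) ?nnegrE ?le_max ?K0 ?lexx ?orbT.
apply: (le_trans (IH m mk y)); rewrite ler_wpM2r ?lp_pow_ge0//.
by rewrite ge0_ler_powR ?(ltW p0) ?nnegrE ?le_max ?K0 ?lexx.
Defined.

(** On each block the operator is inverted by the calculus of 1/z, so every
function supported by finitely many blocks lies in the range. *)
Lemma dyadic_op_dense_range : dense_range dyadic_op.
Proof.
move=> O [x Ox] oO.
have [e /= e0 eO] : nbhs_ball x O by apply/nbhs_ballP; exact: open_nbhs_nbhs.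
have eE : e = (complex.Re e)%:C.
  by move: e0; case: (e) => a b; rewrite ltcE /= => /andP[/eqP -> _].
have e0' : 0 < complex.Re e by move: e0; rewrite eE -(rmorph0 (@real_complex R)) ltcR.
pose inv (j : nat) : C := ((dyadic j)^-1)%:C.
have idb m : exists2 K, 0 <= K & forall y : block_type m -> C, lp_pow p y <= K `^ p * lp_pow p y.
  by exists 1 => // y; rewrite powR1 mul1r.
pose N := @truncated (fun m y => y) (fun m a x z => erefl) idb.
pose L := @truncated (fun m y => calc inv y) (fun m a x z => calc_linear inv a x z) (calc_block_bounded inv).
have [k xk] := @Lpop_trunc R block_type card_block_type p p1 N x (fun k m y => erefl) _ e0'.
exists (Lpop card_block_type (N k) x); split.
  apply: eO; rewrite /= -ball_normE /ball_ /= [`|_|]rnormE eE ltcR; exact: xk.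
exists (Lpop card_block_type (L k) x) => //=.
rewrite (multiplierE bvar_dyadic); apply/esym/Lpop_comp => m y /=.
case: ifP => _.
  rewrite calc_mul (_ : (fun j => _) = fun=> 1) ?calc1//.
  by apply/funext => j; rewrite /inv -rmorphM /= mulfV// gt_eqF// dyadic_gt0.
by have := calc_linear (fun j => (dyadic j)%:C) (-1) (0 : block_type m -> C) 0; rewrite scaler0 addr0 scaleN1r addNr.
Qed.

Lemma dyadic_op_sectorial_of_angle w : 0 < w -> sectorial_of_angle dyadic_op w.
Proof.
move=> w0; split => [l|e e0].
  apply: contraPP => lw sp; apply: sp.
  by have [c c0 /(_ l lw)[l0 lc]] := sector_dist_pos w0; exact: (in_resolvent_set c0 l0 lc).
have [c c0 hc] := sector_dist_pos (addr_gt0 w0 e0).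
apply: (@le_lt_trans _ _ (2 * (2 / c ^+ 2 + c^-1))%:E); last exact: ltry.
apply: ub_ereal_sup => _ [_ [l lw <-] <-].
apply: ub_ereal_sup => _ [x x1 <-]; rewrite lee_fin.
have [l0 lc] := hc l lw.
rewrite (le_trans (scaled_resolvent_norm c0 l0 lc x))// ler_piMr//.
by rewrite mulr_ge0// addr_ge0 ?divr_ge0 ?invr_ge0 ?exprn_ge0 ?(ltW c0).
Qed.

Lemma dyadic_op_sectorial : sectorial dyadic_op.
Proof.
split; [exact: dyadic_op_closed|exact: dyadic_op_dense|exact: dyadic_op_dense_range|].
exists (pi / 2); split; first by rewrite divr_gt0 ?pi_gt0//= ltr_pdivrMr// ltr_pMr ?pi_gt0// ltr1n.
by apply: dyadic_op_sectorial_of_angle; rewrite divr_gt0 ?pi_gt0.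
Qed.

Lemma dyadic_op_angle : sectorial_angle dyadic_op = 0.
Proof.
rewrite /sectorial_angle (_ : [set w | _] = `]0, pi[%classic); last first.
  apply/seteqP; split => w; rewrite /= in_itv /=; first by case.
  by move=> wpi; split => //; apply: dyadic_op_sectorial_of_angle; case/andP: wpi.
by rewrite inf_itv// bnd_simp pi_gt0.
Qed.

End multiplier.

(** * Step functions *)

Section step_functions.
Context (R : realType) (I : nat -> finType) (I0 : forall m, (0 < #|I m|)%N).
Context (p : R) (p1 : 1 <= p).
Local Notation C := R[i].
Local Notation T := (measurableTypeR R).
Local Notation lo := (@lo R I _).
Local Notation len := (len R I).
Local Notation mu := (lebesgue01 R).
Local Notation V := (Lp mu p1).
Implicit Types Y Z : forall m, I m -> C.

Let p0 : 0 < p. Proof. exact: lt_le_trans p1. Qed.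

(** The data Y are indexed by all blocks, although only block m0 contributes, to
avoid transporting them along equalities between block numbers. *)
Definition stepf m0 Y : T -> C := fun s =>
  if piece_label I s is Some mi then (if tag mi == m0 then Y (tag mi) (tagged mi) else 0) else 0.

Lemma stepfE m0 Y m (i : I m) t : 0 <= t < len m ->
  stepf m0 Y (lo i + t) = if m == m0 then Y m i else 0.
Proof.
move=> tl; rewrite /stepf (@piece_labelE _ _ I0 m i)//.
by apply/pieceP; exists t.
Qed.

Lemma cmeasurable_stepf m0 Y : cmeasurable (stepf m0 Y).
Proof.
have E m (i : I m) s : piece i s -> stepf m0 Y s = if m == m0 then Y m i else 0.
  by move=> /pieceP[t tl ->]; rewrite stepfE.
split; [pose h := @complex.Re R | pose h := @complex.Im R];
  apply: (measurable_pieces (G := fun m i s => h (if m == m0 then Y m i else 0))).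
- by move=> m i; exact: measurable_cst.
- by move=> m i s /E ->.
- by move=> s ls; rewrite /stepf ls.
- by move=> m i; exact: measurable_cst.
- by move=> m i s /E ->.
- by move=> s ls; rewrite /stepf ls.
Qed.

Lemma Lpnorm_stepf m0 Y :
  (Lpnorm mu p (stepf m0 Y) `^ p = (len m0 * lp_pow p (Y m0))%:E)%E.
Proof.
rewrite (Lpnorm_fiber I0 p1 (cmeasurable_stepf m0 Y)).
have E m : (\int[lebesgue_measure]_(t in `[0%R, len m[)
    (lp_pow p (fiber t (stepf m0 Y) : I m -> C))%:E =
    if m == m0 then (len m0 * lp_pow p (Y m0))%:E else 0)%E.
  transitivity (\int[lebesgue_measure]_(t in `[0%R, len m[)
      (if m == m0 then (lp_pow p (Y m0))%:E else 0))%E.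
    apply: eq_integral => t; rewrite inE /= in_itv /= => tl.
    rewrite (_ : fiber t _ = if m == m0 then Y m else fun=> 0); last first.
      by apply/funext => i; rewrite /fiber stepfE//; case: ifP.
    case: eqP => [->//|_]; congr EFin.
    by rewrite /lp_pow big1// => i _; rewrite rnorm0 powR0// gt_eqF.
  case: eqP => [->|_]; last by rewrite integral0.
  rewrite integral_cst//= lebesgue_measure_itv /= lte_fin (len_gt0 _ I0).
  by rewrite sube0 muleC.
under eq_eseriesr do rewrite E.
rewrite (nneseriesD1 (n := m0))//; last first.
  by move=> m _; case: ifP => // _; rewrite lee_fin mulr_ge0 ?lp_pow_ge0// ltW// len_gt0.
rewrite eqxx eseries0 ?adde0// => m _ /=.
by move=> /negbTE ->.
Qed.

Lemma stepf_Lp m0 Y : stepf m0 Y \in Lp_pred mu p.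
Proof.
apply/isLpP; have [m1 m2] := cmeasurable_stepf m0 Y; split => //.
apply: (@lty_poweRy _ _ p); first by rewrite gt_eqF.
by rewrite Lpnorm_stepf ltry.
Qed.

Definition Lstep m0 Y : V := Lp_class p1 (stepf_Lp m0 Y).

Lemma Lstep_norm m0 Y : rnorm (Lstep m0 Y) `^ p = len m0 * lp_pow p (Y m0).
Proof.
apply: EFin_inj; rewrite -Lpnorm_stepf -(rnorm_Lp_class p1 (stepf_Lp m0 Y)).
by rewrite poweR_EFin.
Qed.

Lemma Lstep_lin_comb m0 a Y Z :
  Lstep m0 (fun m i => a * Y m i + Z m i) = a *: Lstep m0 Y + Lstep m0 Z.
Proof.
rewrite Lp_class_lin_comb; apply: (Lp_fiber_ext I0) => m i t tl; rewrite !fctE !stepfE//.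
by case: ifP => // _; rewrite scaler0 addr0.
Qed.

Lemma Lstep0 m0 : Lstep m0 (fun m i => 0) = 0.
Proof.
by apply: (Lp_fiber_ext I0) => m i t tl; rewrite stepfE//; case: ifP.
Qed.

Lemma Lstep_sum m0 n (c : 'I_n -> C) (Y : 'I_n -> forall m, I m -> C) :
  \sum_k c k *: Lstep m0 (Y k) = Lstep m0 (fun m i => \sum_k c k * Y k m i).
Proof.
elim: (index_enum _) => [|k s IH].
  by rewrite big_nil -(Lstep0 m0); congr Lstep; apply: functional_extensionality_dep => m; apply/funext => i; rewrite big_nil.
rewrite big_cons IH -Lstep_lin_comb; congr Lstep; apply: functional_extensionality_dep => m; apply/funext => i.
by rewrite big_cons.
Qed.

Lemma Lpop_Lstep (L : fibered I p) m0 Y :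
  Lpop I0 (p1 := p1) L (Lstep m0 Y) = Lstep m0 (fun m => L m (Y m)).
Proof.
rewrite Lpop_class; apply: (Lp_fiber_ext I0) => m i t tl.
rewrite fiberopE// stepfE//.
rewrite (_ : fiber t _ = if m == m0 then Y m else 0); last first.
  by apply/funext => j; rewrite /fiber stepfE//; case: ifP.
case: ifP => // _.
have := @fib_linear _ _ _ L m (-1) 0 0.
by rewrite scaler0 addr0 scaleN1r addNr => ->.
Qed.

End step_functions.

(** * Rademacher averages *)

Section rademacher.
Context (R : realType).
Local Notation C := R[i].
Local Notation T := (measurableTypeR R).
Local Notation mu := (lebesgue01 R).

Lemma measurable_rademacher k : measurable_fun setT (rademacher k : T -> R).
Proof.
apply: (@measurableT_comp _ _ _ _ _ _ (@Num.sg R)).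
  apply: nondecreasing_measurable => // x y xy.
  have [x0|x0|x0] := ltgtP x 0.
  - by rewrite (ltr0_sg x0); case: (ltgtP y 0) => y0; rewrite ?(ltr0_sg y0) ?(gtr0_sg y0) ?y0 ?sgr0//; lra.
  - by rewrite (gtr0_sg x0) gtr0_sg// (lt_le_trans x0).
  - by rewrite x0 sgr0 sgr_ge0 -x0.
apply: measurableT_comp.
  by apply: continuous_measurable_fun; exact: continuous_sin.
by apply: measurable_funM => //; exact: measurable_cst.
Qed.

Lemma rademacher_le1 k t : `|rademacher k t : R| <= 1.
Proof. by rewrite normr_sg; case: (_ != 0). Qed.

(** The zeros of all Rademacher functions are dyadic rationals, since the sine
vanishes only at integer multiples of pi. *)
Lemma rademacher_ae : {ae mu, forall t, forall k, `|rademacher k t : R| = 1}.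
Proof.
(* The complement of [0,1] is a null set and joins the exceptional set. *)
pose Q : set T := [set (j.1%:R / 2 ^+ j.2 : R) | j in [set: nat * nat]].
have cQ : countable Q by apply: (sub_countable (card_image_le _ _)); exact: countableP.
have mQ : measurable Q by exact: countable_measurable.
exists (Q `|` ~` `[0, 1]%classic); split.
- by apply: measurableU => //; apply: measurableC; exact: measurable_itv.
- rewrite /= /lebesgue01 /mrestr setIUl setICl setU0.
  apply/eqP; rewrite -measure_le0 -(countable_lebesgue_measure0 cQ).
  apply: le_measure; rewrite ?inE//; first exact: measurableI.
move=> t /= /existsNP[k rk].
case: (pselect (`[0, 1]%classic t)) => [|h]; last by right.
rewrite /= in_itv /= => /andP[t0 t1]; left.
have s0 : sin (2 ^+ k * pi * t) = 0.
  by apply: contra_notP rk => /eqP s0; rewrite /rademacher normr_sg s0.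
set x := 2 ^+ k * pi * t in s0.
have x0 : 0 <= x / pi by rewrite divr_ge0 ?mulr_ge0 ?exprn_ge0 ?pi_ge0.
have /andP[j1 j2] := truncn_itv x0; set j := Num.truncn _ in j1 j2.
have pp := pi_gt0 R.
have xE : x = (x - pi *+ j) + pi *+ j by rewrite subrK.
have y0 : x - pi *+ j = 0.
  apply/eqP/negPn/negP => yn0.
  have : 0 < sin (x - pi *+ j).
    apply: sin_gt0_pi; apply/andP; split.
      rewrite lt_neqAle eq_sym yn0 subr_ge0 -mulr_natl.
      by rewrite -ler_pdivlMr.
    rewrite ltrBlDl -mulrSr -[pi *+ _]mulr_natl.
    by rewrite -ltr_pdivrMr.
  have := alternatingn (@sinDpi R) j (x - pi *+ j); rewrite subrK s0 => /esym/eqP.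
  by rewrite mulf_eq0 signr_eq0 /= => /eqP ->; rewrite ltxx.
exists (j, k) => //=.
have -> : t = x / (2 ^+ k * pi) by rewrite /x [_ * t]mulrC mulfK// mulf_neq0 ?expf_neq0 ?pnatr_eq0// gt_eqF.
have pn0 : (pi : R) != 0 by rewrite gt_eqF.
by rewrite xE y0 add0r -[pi *+ j]mulr_natl [2 ^+ k * pi]mulrC invfM mulrA mulfK.
Qed.

Lemma mu_setT : mu setT = 1%E.
Proof.
rewrite /lebesgue01 /= /mrestr setTI lebesgue_measure_itv /= lte_fin ltr01.
by rewrite sube0.
Qed.

Section Lq_bounds.
Variables (q : R) (q1 : 1 <= q) (G : T -> R).
Hypothesis mG : measurable_fun setT G.
Hypothesis G0 : forall t, 0 <= G t.

Let q0 : 0 < q. Proof. exact: lt_le_trans q1. Qed.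

Let Nq : ('N[mu]_(q%:E)[(fun t => (G t)%:E)] `^ q = \int[mu]_t (G t `^ q)%:E)%E.
Proof.
rewrite poweR_Lnorm; last by rewrite gt_eqF.
by apply: eq_integral => t _; rewrite gee0_abs ?lee_fin// poweR_EFin.
Qed.

Let mGq : measurable_fun setT (fun t => (G t `^ q)%:E).
Proof.
apply/measurable_EFinP.
exact: (@measurableT_comp _ _ _ _ _ _ (@powR R ^~ q)).
Qed.

Let poweR_le (x y : \bar R) : (0 <= x)%E -> (0 <= y)%E ->
  (x `^ q <= y `^ q)%E -> (x <= y)%E.
Proof.
move=> x0 y0 h; have := gt0_ler_poweR (r := q^-1) _ _ _ h.
rewrite !in_itv /= !leey !andbT -!poweRrM mulfV ?gt_eqF// !poweRe1//.
by apply; rewrite ?poweR_ge0// invr_ge0 ltW.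
Qed.

Let int_cst (b : R) : (\int[mu]_t (b `^ q)%:E = b%:E `^ q)%E.
Proof. by rewrite integral_cst// [X in (_ * X)%E]mu_setT mule1 poweR_EFin. Qed.

Lemma Lnorm_le_cst b : 0 <= b -> (forall t, G t <= b) ->
  ('N[mu]_(q%:E)[(fun t => (G t)%:E)] <= b%:E)%E.
Proof.
move=> b0 Gb; apply: poweR_le; rewrite ?Lnorm_ge0 ?lee_fin// Nq -int_cst.
apply: ge0_le_integral => //.
- by move=> t _; rewrite lee_fin powR_ge0.
by move=> t _; rewrite lee_fin ge0_ler_powR ?nnegrE ?(ltW q0).
Qed.

Lemma Lnorm_ge_cst b : 0 <= b -> {ae mu, forall t, b <= G t} ->
  (b%:E <= 'N[mu]_(q%:E)[(fun t => (G t)%:E)])%E.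
Proof.
move=> b0 Gb; apply: poweR_le; rewrite ?Lnorm_ge0 ?lee_fin// Nq -int_cst.
apply: ae_ge0_le_integral => //.
- by move=> t _; rewrite lee_fin powR_ge0.
- by move=> t _; rewrite lee_fin powR_ge0.
apply: filterS Gb => t Gt _.
by rewrite lee_fin ge0_ler_powR ?nnegrE ?(ltW q0).
Qed.

End Lq_bounds.

End rademacher.

(** * Failure of R-boundedness *)

Section lower_bound.
Context (R : realType) (m : nat).
Local Notation C := R[i].
Local Notation cube := (cube m).

Lemma sum_digit_sign_sqr (e : 'I_m -> R) :
  \sum_(w : cube) rnorm (\sum_k (e k)%:C * digit_sign R k w) ^+ 2 = 2 ^+ m * \sum_k e k ^+ 2.
Proof.
have realE w : exists v : R, \sum_k (e k)%:C * digit_sign R k w = v%:C.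
  exists (\sum_k e k * (-1) ^+ w k); rewrite rmorph_sum; apply: eq_bigr => k _.
  by rewrite rmorphM rmorphXn rmorphN1.
apply: (@complexI R); rewrite rmorphM rmorphXn rmorph_nat !rmorph_sum /=.
transitivity (\sum_(w : cube) (\sum_k (e k)%:C * digit_sign R k w) ^+ 2).
  apply: eq_bigr => w _; have [v ->] := realE w.
  by rewrite rnormC real_normK ?num_real// rmorphXn.
transitivity (\sum_(w : cube) \sum_k \sum_l
    ((e k)%:C * (e l)%:C) * (digit_sign R k w * digit_sign R l w)).
  apply: eq_bigr => w _; rewrite expr2 mulr_suml; apply: eq_bigr => k _.
  by rewrite mulr_sumr; apply: eq_bigr => l _; rewrite mulrACA.
rewrite exchange_big /= mulr_sumr; apply: eq_bigr => k _.
rewrite exchange_big /= (bigD1 k)//= [X in _ + X]big1 ?addr0 => [|l lk]; last first.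
  by rewrite -mulr_sumr sum_digit_sign_neq ?mulr0// eq_sym.
under eq_bigr => w _ do rewrite -signr_addb addbb expr0 mulr1.
by rewrite sumr_const card_cube -[_ *+ _ ^ _]mulr_natl natrX rmorphXn expr2.
Qed.

(** Orthogonality of the signs gives the mean square, and Jensen's inequality
for the exponent p / 2 >= 1 bounds the p-th mean from below. *)
Lemma sum_digit_sign_powR p (e : 'I_m -> R) (a : R) : 2 <= p -> (forall k, e k ^+ 2 = a) ->
  2 ^+ m * (m%:R * a) `^ (p / 2) <=
  \sum_(w : cube) rnorm (\sum_k (e k)%:C * digit_sign R k w) `^ p.
Proof.
move=> p2 ea.
have q1 : 1 <= p / 2 by rewrite ler_pdivlMr// mul1r.
have M0 : 0 < 2 ^+ m :> R by rewrite exprn_gt0.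
have := jensen_powR (index_enum cube) (w := fun=> 1)
  (z := fun w => rnorm (\sum_k (e k)%:C * digit_sign R k w) ^+ 2) q1 (fun=> ler01) (fun=> sqr_ge0 _).
under eq_bigr do rewrite mul1r.
rewrite sum_digit_sign_sqr; under eq_bigr do rewrite ea.
rewrite sumr_const card_ord -[a *+ m]mulr_natl.
have -> : \sum_(k : cube) (1 : R) = 2 ^+ m by rewrite sumr_const card_cube natrX.
under [X in _ <= _ * X -> _]eq_bigr => w _.
  rewrite mul1r -powR_mulrn ?rnorm_ge0// -powRrM (_ : 2%:R * (p / 2) = p); last by field.
  over.
have [m0|m0] := eqVneq m 0%N.
  move=> _; rewrite {1 2}m0 mul0r powR0 ?mulr0; last by rewrite gt_eqF// (lt_le_trans _ q1).
  by apply: sumr_ge0 => w _; exact: powR_ge0.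
have a0 : 0 <= a.
  have mp : (0 < m)%N by rewrite lt0n.
  by rewrite -(ea (Ordinal mp)) sqr_ge0.
rewrite powRM ?mulr_ge0 ?(ltW M0)// => h.
rewrite -(ler_pM2l (powR_gt0 (p / 2 - 1) M0)) mulrA.
by rewrite [X in X * _ <= _]mulrC mulr_powRB1 ?(ltW M0)// (lt_le_trans _ q1).
Qed.

End lower_bound.

Section not_R_sectorial.
Context (R : realType) (p : R) (hp : 2 < p).
Local Notation C := R[i].
Local Notation T := (measurableTypeR R).
Let p1 : 1 <= p := ge1_gt2 hp.
Let p0 : 0 < p. Proof. exact: lt_le_trans p1. Qed.
Local Notation L := (Lstep card_block_type p1).
Local Notation len := (len R block_type).

(** The vector x_k of block m, and 0 in blocks with fewer coordinates. *)
Definition coord (k : nat) m (i : block_type m) : C :=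
  if i.1 is Some n then (n == k :> nat)%:R else 0.

(** The point at which the resolvent separates the two eigenvalues seen by x_k:
minus the smaller of them. *)
Definition pole (k : nat) : C := - (dyadic R k.*2.+2)%:C.

(** By homogeneity the two values l / (l - z) are 1/3 and 1/2 for every k. *)
Lemma pole_gap k :
  pole k * (resolvent_symbol (pole k) k.*2.+1 - resolvent_symbol (pole k) k.*2.+2) = (- 6^-1)%:C.
Proof.
have d0 := dyadic_gt0 R k.*2.+2.
rewrite /pole /resolvent_symbol; set d := dyadic R k.*2.+2 in d0 *.
have -> : dyadic R k.*2.+1 = 2 * d.
  by rewrite /d /dyadic [in RHS]exprS mulrA mulfV ?mul1r// pnatr_eq0.
rewrite -!rmorphN -!rmorphD -!fmorphV -!rmorphN -!rmorphD -!rmorphM; congr _%:C.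
by field; apply/andP; split; rewrite lt_eqF//; lra.
Qed.

Lemma calc_coord (phi : nat -> C) m (k : 'I_m) w :
  calc phi (@coord k m) (None, w) = (phi k.*2.+1 - phi k.*2.+2) * digit_sign R k w.
Proof.
rewrite /= /calc_corner [X in (X + _) w]big1 => [|j _]; last first.
  have -> : (fun e => @coord k m (None, e)) = 0 by [].
  have md0 : mart_diff j (0 : cube m -> C) = 0 by exact: linear0.
  by rewrite md0 scaler0.
rewrite add0r fct_sumE (bigD1 k)//= big1 ?addr0 => [|n nk].
  rewrite /coord /= eqxx /mean sum_cst_cube mulr1.
  by rewrite -[LHS]/(_ * digit_sign R k w).
rewrite /coord /= (_ : (n == k :> nat) = false); last by apply/negbTE.
by rewrite /mean big1// !mulr0 scale0r.
Qed.

Lemma rademacher_LstepE m (Z : 'I_m -> forall m', block_type m' -> C) t :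
  rnorm (\sum_(k < m) (rademacher k.+1 t : R)%:C *: L m (Z k)) =
  (len m * lp_pow p (fun i : block_type m => \sum_(k < m) (rademacher k.+1 t : R)%:C * Z k m i)) `^ p^-1.
Proof.
set Y := fun m' (i : block_type m') => \sum_(k < m) (rademacher k.+1 t : R)%:C * Z k m' i.
rewrite Lstep_sum -/Y -(Lstep_norm card_block_type p1 m Y) -powRrM mulfV ?gt_eqF//.
by rewrite powRr1// rnorm_ge0.
Qed.

Lemma measurable_rademacher_Lstep m (Z : 'I_m -> forall m', block_type m' -> C) :
  measurable_fun setT ((fun t => rnorm (\sum_(k < m) (rademacher k.+1 t : R)%:C *: L m (Z k))) : T -> R).
Proof.
under eq_fun do rewrite rademacher_LstepE.
apply: (@measurableT_comp _ _ _ _ _ _ (@powR R ^~ p^-1)) => //.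
apply: measurable_funM; first exact: measurable_cst.
apply: measurable_sum => i; apply: measurable_powR_rnorm.
split.
  under eq_fun do rewrite Re_sum.
  apply: measurable_sum => k; under eq_fun do rewrite Re_realM.
  by apply: measurable_funM => //; exact: measurable_rademacher.
under eq_fun do rewrite Im_sum.
apply: measurable_sum => k; under eq_fun do rewrite Im_realM.
by apply: measurable_funM => //; exact: measurable_rademacher.
Qed.

(** Apply the resolvents at the poles of ranks below m to the coordinate vectors
of block m. For almost every t the signed sum of the images has at least the norm
of one sixth of a signed sum of r_1, ..., r_m, while the signed sum of the
coordinate vectors has disjointly supported terms. The measure of the pieces
enters both norms in the same way and cancels. *)
Lemma dyadic_op_not_R_sectorial : ~ R_sectorial (dyadic_op p1).
Proof.
move=> [w []]; rewrite dyadic_op_angle => wpi [q q1 [K K0 RB]].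
(* The estimate sqrt m / 6 <= K m^(1/p), raised to the power p. *)
have key m : (m%:R / 36) `^ (p / 2) <= K `^ p * m%:R.
  pose x (k : 'I_m) := L m (coord k).
  pose S (k : 'I_m) := fun y : Lp (lebesgue01 R) p1 => pole k *: resolvent (dyadic_op p1) (pole k) y.
  have notin k : ~ closure (sector w) (pole k : C^o) by apply: (neg_notin_sector wpi); exact: dyadic_gt0.
  have hS k : scaled_resolvents (dyadic_op p1) w (S k) by exists (pole k) => //; exact: notin.
  pose Z (k : 'I_m) : forall m', block_type m' -> C :=
    fun m' i => pole k * calc (resolvent_symbol (pole k)) (@coord k m') i.
  have SxE k : S k (x k) = L m (Z k).
    have /andP[w0 _] := wpi.
    have [c c0 /(_ _ (notin k))[l0 lc]] := sector_dist_pos w0.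
    rewrite /S (resolventE p1 c0 l0 lc) (multiplierE (bvar_resolvent_ex c0 l0 lc)) /x Lpop_Lstep.
    transitivity (L m (fun m' i => pole k * calc (resolvent_symbol (pole k)) (@coord k m') i + 0)).
      by rewrite Lstep_lin_comb Lstep0 addr0.
    by congr Lstep; apply: functional_extensionality_dep => m'; apply/funext => i; rewrite addr0.
  have l0 : 0 < len m by exact: (len_gt0 _ card_block_type).
  have M0 : 0 < 2 ^+ m :> R by rewrite exprn_gt0.
  have len_powR_le a b : 0 <= a -> a <= b -> (len m * a) `^ p^-1 <= (len m * b) `^ p^-1.
    move=> a0 ab; apply: ge0_ler_powR; rewrite ?nnegrE.
    - by rewrite invr_ge0 ltW.
    - by apply: mulr_ge0 => //; exact: ltW.
    - by apply: mulr_ge0; [exact: ltW|exact: le_trans ab].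
    - by rewrite ler_pM2l.
  pose lowb := (len m * (2 ^+ m * (m%:R / 36) `^ (p / 2))) `^ p^-1.
  pose upb := (len m * (m%:R * 2 ^+ m)) `^ p^-1.
  have ineq : lowb <= K * upb.
    rewrite -lee_fin EFinM.
    have := RB m S x hS; rewrite /rademacher_norm.
    under eq_fun do under eq_bigr do rewrite SxE.
    move=> h; apply: (le_trans _ (le_trans h _)).
      apply: Lnorm_ge_cst => //.
      - exact: measurable_rademacher_Lstep.
      - by move=> t; exact: rnorm_ge0.
      - exact: powR_ge0.
      have [N [mN N0 hN]] := rademacher_ae R; exists N; split => // t /= nt.
      apply: hN => /= et; apply: nt.
      rewrite rademacher_LstepE; apply: len_powR_le.
        by apply: mulr_ge0; [exact: ltW|exact: powR_ge0].
      rewrite /lp_pow sum_block_index.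
      apply: ler_wpDr.
        by apply: sumr_ge0 => n _; apply: sumr_ge0 => v _; exact: powR_ge0.
      have e36 (k : 'I_m) : (- (rademacher k.+1 t : R) / 6) ^+ 2 = 36^-1.
        rewrite exprMn sqrrN -[_ ^+ 2]real_normK ?num_real// et expr1n mul1r.
        by rewrite exprVn -natrX.
      apply: (le_trans (sum_digit_sign_powR (ltW hp) e36)).
      apply: ler_sum => v _; rewrite le_eqVlt; apply/orP; left; apply/eqP.
      congr (rnorm _ `^ p); apply: eq_bigr => k _.
      rewrite /Z calc_coord [in RHS]mulrA [in RHS]mulrA; congr (_ * _).
      rewrite -mulrA pole_gap -rmorphM; congr _%:C; ring.
    rewrite lee_wpmul2l ?lee_fin//; apply: Lnorm_le_cst => //.
    - exact: measurable_rademacher_Lstep.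
    - by move=> t; exact: rnorm_ge0.
    - exact: powR_ge0.
    move=> t.
    rewrite rademacher_LstepE; apply: len_powR_le; first exact: lp_pow_ge0.
    rewrite /lp_pow sum_block_index.
    rewrite big1 ?add0r => [|v _]; last first.
      by rewrite big1 => [|k _]; rewrite ?rnorm0 ?powR0 ?gt_eqF// /coord /= mulr0.
    apply: (@le_trans _ _ (\sum_(n < m) \sum_(v : cube m) 1)); last first.
      by rewrite sumr_const card_ord -[_ *+ m]mulr_natl sumr_const card_cube natrX.
    apply: ler_sum => n _; apply: ler_sum => v _.
    rewrite (bigD1 n)//= big1 => [|k kn]; last first.
      by rewrite /coord /= (_ : (n == k :> nat) = false) ?mulr0//; apply/negbTE; rewrite eq_sym.
    rewrite /coord /= eqxx mulr1 addr0 rnormC.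
    apply: (@le_trans _ _ (1 `^ p)); last by rewrite powR1.
    by rewrite ge0_ler_powR ?nnegrE ?(ltW p0) ?rademacher_le1.
  have := ge0_ler_powR (ltW p0) _ _ ineq.
  rewrite !nnegrE mulr_ge0 ?powR_ge0// => /(_ isT isT).
  rewrite powRM ?powR_ge0// /lowb /upb -!powRrM mulVf ?gt_eqF//.
  rewrite !powRr1; last 2 first.
  - by apply: mulr_ge0; [exact: ltW|apply: mulr_ge0 => //; exact: ltW].
  - by apply: mulr_ge0; [exact: ltW|apply: mulr_ge0; [exact: ltW|exact: powR_ge0]].
  by rewrite [leRHS]mulrCA ler_pM2l// [m%:R * 2 ^+ m]mulrC [leRHS]mulrCA ler_pM2l.
have r1 : 0 < p / 2 - 1 by rewrite subr_gt0 ltr_pdivlMr// mul1r.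
pose B := 36 `^ (p / 2) * K `^ p.
have B0 : 0 <= B by rewrite mulr_ge0 ?powR_ge0.
(* As p > 2, m^(p/2 - 1) is unbounded, which contradicts the estimate. *)
pose m := (Num.truncn ((B + 1) `^ (p / 2 - 1)^-1)).+1.
have mB : (B + 1) `^ (p / 2 - 1)^-1 <= m%:R by rewrite ltW// truncnS_gt.
have m0 : 0 < m%:R :> R by rewrite ltr0n.
have := ge0_ler_powR (ltW r1) _ _ mB; rewrite !nnegrE powR_ge0 (ltW m0) => /(_ isT isT).
rewrite -powRrM mulVf ?gt_eqF// powRr1; last by rewrite addr_ge0.
have := key m; rewrite powRM ?invr_ge0 ?(ltW m0)//.
have h36 : 0 < 36 `^ (p / 2) :> R by rewrite powR_gt0.
have -> : (36^-1 : R) `^ (p / 2) = (36 `^ (p / 2))^-1 by rewrite -powR_inv1// -powRrM mulN1r powRN.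
rewrite ler_pdivrMr// -(mulr_powRB1 (ltW m0)); last by lra.
rewrite mulrAC [_ * m%:R]mulrC ler_pM2l// [K `^ p * _]mulrC -/B => h1 h2.
by have := le_trans h2 h1; rewrite gerDl ler10.
Qed.

End not_R_sectorial.

Theorem theorem3p18 (R : realType) (p : R) (hp : 2 < p) :
  exists A : operator (Lp (lebesgue01 R) (ge1_gt2 hp)),
    sectorial A /\ sectorial_angle A = 0 /\ ~ R_sectorial A.
Proof.
exists (dyadic_op (ge1_gt2 hp)); split; first exact: dyadic_op_sectorial.
by split; [exact: dyadic_op_angle|exact: dyadic_op_not_R_sectorial].
Qed.
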